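(* Let $n\ge3$ be an integer and let $\Theta\subset\mathbb{R}^n$ be a bounded smooth domain with $\overline\Theta\subset(0,\infty)\times\mathbb{R}^{n-1}$. Let $\alpha:=\min_{x\in\overline\Theta}x_1$ and $\beta:=\max_{x\in\overline\Theta}x_1$. If $\frac{\beta}{\alpha}\le\frac{n}{n-2}$, then $$\lambda_{0,*}^{[k]}\ge\frac{k^2}{4\beta^2}>0\qquad\text{for all integers }k\ge1,$$ where $\lambda_{0,*}^{[k]}$ is defined in the context.
   Context: Let $2^*:=\frac{2n}{n-2}$. For an integer $k\ge1$ and $\lambda\in\mathbb{R}$ let $J_\lambda:H_0^1(\Theta)\to\mathbb{R}$, $$J_\lambda(u):=\frac12\int_\Theta x_1^k|\nabla u|^2-\frac\lambda2\int_\Theta x_1^ku^2-\frac1{2^*}\int_\Theta x_1^k|u|^{2^*},$$ the energy functional of the problem $-\mathrm{div}(x_1^k\nabla u)=\lambda x_1^ku+x_1^k|u|^{2^*-2}u$ in $\Theta$, $u=0$ on $\partial\Theta$. Let $\lambda_1^{[k]}>0$ be the first eigenvalue of $-\mathrm{div}(x_1^k\nabla u)=\lambda x_1^ku$ in $\Theta$, $u=0$ on $\partial\Theta$. For $\lambda<\lambda_1^{[k]}$ let $\mathcal{N}_\lambda:=\{u\in H_0^1(\Theta)\smallsetminus\{0\}:J_\lambda'(u)u=0\}$ and $\ell_\lambda^{[k]}:=\inf_{\mathcal{N}_\lambda}J_\lambda$. Let $S$ be the best Sobolev constant in $\mathbb{R}^n$, i.e. the largest constant with $S(\int_{\mathbb{R}^n}|u|^{2^*})^{2/2^*}\le\int_{\mathbb{R}^n}|\nabla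 u|^2$ for all $u\in H^1(\mathbb{R}^n)$. Set $\kappa^{[k]}:=\left(\min_{x\in\overline\Theta}x_1^k\right)\frac1nS^{n/2}$ and $$\lambda_{0,*}^{[k]}:=\inf\{\lambda\in(-\infty,\lambda_1^{[k]}):\ell_\lambda^{[k]}<\kappa^{[k]}\}.$$ *)

(* Defs.v *)
From HB Require Import structures.
From mathcomp Require Import all_boot all_order all_algebra.
From mathcomp Require Import all_classical all_reals all_analysis.

Set Implicit Arguments.
Unset Strict Implicit.
Unset Printing Implicit Defensive.

Import Order.TTheory GRing.Theory Num.Theory.
Import numFieldNormedType.Exports.

Local Open Scope classical_set_scope.
Local Open Scope ring_scope.

(* The sigma-algebra generated by the coordinates, i.e. the Borel one, in the
   same way as the library does for tuples. *)
Section measurable_rV.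
Context {R : realType} (n : nat).

Let coors : 'I_n -> 'rV[R]_n -> R := fun i x => x ord0 i.

Let rV_set0 : g_sigma_preimage coors set0.
Proof. exact: sigma_algebra0. Qed.

Let rV_setC A : g_sigma_preimage coors A -> g_sigma_preimage coors (~` A).
Proof. exact: sigma_algebraC. Qed.

Let rV_bigcup (F : (set 'rV[R]_n)^nat) :
  (forall i, g_sigma_preimage coors (F i)) ->
  g_sigma_preimage coors (\bigcup_i (F i)).
Proof. exact: sigma_algebra_bigcup. Qed.

HB.instance Definition _ := @isMeasurable.Build default_measure_display
  'rV[R]_n (g_sigma_preimage coors) rV_set0 rV_setC rV_bigcup.

End measurable_rV.

Section measurable_coord.
Context {R : realType}.

Lemma measurable_coord n (i : 'I_n) :
  measurable_fun [set: 'rV[R]_n] (fun x : 'rV[R]_n => x ord0 i).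
Proof.
move=> _ Y mY; rewrite setTI; apply: sub_sigma_algebra => /=.
rewrite -bigcup_seq/=; exists i => /=; first by rewrite mem_index_enum.
by exists Y => //; rewrite setTI.
Qed.

Lemma measurable_fun_rV d (T : measurableType d) n (f : T -> 'rV[R]_n) :
  (forall i, measurable_fun [set: T] (fun t => f t ord0 i)) ->
  measurable_fun [set: T] f.
Proof.
move=> mf.
suff fS : g_sigma_preimage (fun i t => f t ord0 i) `<=` @measurable _ T.
  move=> _ A mA; apply: fS; move: mA.
  rewrite (@g_sigma_preimage_comp _ _ n _ (fun i (x : 'rV[R]_n) => x ord0 i)).
  by exists A.
apply: smallest_sub; first exact: sigma_algebra_measurable.
case: n => [|n] in f mf *; first by rewrite big_ord0.
rewrite -bigcup_mkord_ord; apply: bigcup_sub => i Ii.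
by move=> A [B mB <-]; exact: mf.
Qed.

End measurable_coord.

Section cons_rV.
Context {R : realType} (n : nat).

Definition cons_rV (p : measurableTypeR R * 'rV[R]_n) : 'rV[R]_n.+1 :=
  row_mx (p.1)%:M p.2.

Definition uncons_rV (x : 'rV[R]_n.+1) : measurableTypeR R * 'rV[R]_n :=
  (x ord0 ord0, \row_j x ord0 (lift ord0 j)).

Lemma cons_rV0 p : cons_rV p ord0 ord0 = p.1.
Proof.
rewrite /cons_rV; have -> : ord0 = lshift n (ord0 : 'I_1) by exact/val_inj.
by rewrite (@row_mxEl R 1 1 n) mxE eqxx mulr1n.
Qed.

Lemma cons_rVS p j : cons_rV p ord0 (lift ord0 j) = p.2 ord0 j.
Proof.
by rewrite /cons_rV -rshift1 (@row_mxEr R 1 1 n).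
Qed.

Lemma cons_rVK : cancel cons_rV uncons_rV.
Proof.
move=> [a x]; rewrite /uncons_rV cons_rV0; congr pair.
by apply/rowP => j; rewrite mxE cons_rVS.
Qed.

Lemma measurable_cons_rV : measurable_fun setT cons_rV.
Proof.
apply: measurable_fun_rV => i; case: (unliftP ord0 i) => [j ->|->].
  rewrite (_ : (fun t => _) = (fun x : 'rV[R]_n => x ord0 j) \o snd).
    by apply: measurableT_comp; [exact: measurable_coord|exact: measurable_snd].
  by apply/funext => p; rewrite cons_rVS.
rewrite (_ : (fun t => _) = fst); first exact: measurable_fst.
by apply/funext => p; rewrite cons_rV0.
Qed.

Lemma measurable_uncons_rV : measurable_fun setT uncons_rV.
Proof.
apply: measurable_fun_pair; first exact: measurable_coord.
apply: measurable_fun_rV => i.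
rewrite (_ : (fun t => _) = (fun x : 'rV[R]_n.+1 => x ord0 (lift ord0 i))).
  exact: measurable_coord.
by apply/funext => x; rewrite mxE.
Qed.

Variable mu : {sigma_finite_measure set 'rV[R]_n -> \bar R}.

Definition lebesgue_cons : set 'rV[R]_n.+1 -> \bar R :=
  pushforward (@lebesgue_measure R \x mu)%E cons_rV.

Let lebesgue_cons0 : lebesgue_cons set0 = 0%E.
Proof. by rewrite /lebesgue_cons /pushforward preimage_set0 measure0. Qed.

Let lebesgue_cons_ge0 A : (0 <= lebesgue_cons A)%E.
Proof. by rewrite /lebesgue_cons /pushforward measure_ge0. Qed.

Let lebesgue_cons_sigma_additive : semi_sigma_additive lebesgue_cons.
Proof.
pose m : {measure set _ -> \bar R} := (@lebesgue_measure R \x mu)%E.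
move=> F mF tF mUF; rewrite /lebesgue_cons /pushforward preimage_bigcup.
apply: (@measure_semi_sigma_additive _ _ _ m).
- by move=> k; rewrite -[X in measurable X]setTI; exact: measurable_cons_rV.
- apply/trivIsetP => /= i j _ _ ij; rewrite -preimage_setI.
  by move/trivIsetP : tF => /(_ _ _ _ _ ij) ->//; rewrite preimage_set0.
- by rewrite -preimage_bigcup -[X in measurable X]setTI;
    exact: measurable_cons_rV.
Qed.

HB.instance Definition _ := isMeasure.Build _ _ _ lebesgue_cons
  lebesgue_cons0 lebesgue_cons_ge0 lebesgue_cons_sigma_additive.

Let lebesgue_cons_sigma_finite : sigma_finite setT lebesgue_cons.
Proof.
have /sigma_finiteP[F [TF ndF Foo]] := sigma_finiteT (@lebesgue_measure R).
have /sigma_finiteP[G [TG ndG Goo]] := sigma_finiteT mu.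
exists (fun k => uncons_rV @^-1` (F k `*` G k)).
  rewrite -preimage_bigcup -(preimage_setT uncons_rV); congr (_ @^-1` _).
  rewrite -setXTT TF TG predeqE => -[x y]; split.
    move=> [/= [i _ Fix] [k _ Gky]]; exists (maxn i k) => //; split.
    - by move: x Fix; exact/subsetPset/ndF/leq_maxl.
    - by move: y Gky; exact/subsetPset/ndG/leq_maxr.
  by move=> [i _ []/= ? ?]; split; exists i.
move=> k; have [? ?] := Foo k; have [? ?] := Goo k; split.
  rewrite -[X in measurable X]setTI; apply: measurable_uncons_rV => //.
  exact: measurableX.
rewrite /lebesgue_cons /pushforward -comp_preimage.
rewrite (_ : uncons_rV \o cons_rV = id) ?preimage_id; last first.
  exact/funext/cons_rVK.
by rewrite product_measure1E// lte_mul_pinfty// ge0_fin_numE.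
Qed.

HB.instance Definition _ := Measure_isSigmaFinite.Build _ _ _ lebesgue_cons
  lebesgue_cons_sigma_finite.

End cons_rV.

(* n-dimensional Lebesgue measure: the n-fold product of the one on R. *)
Fixpoint lebesgue_rV (R : realType) (n : nat) :
    {sigma_finite_measure set 'rV[R]_n -> \bar R} :=
  match n with
  | 0 => \d_(0 : 'rV[R]_0)
  | m.+1 => lebesgue_cons (lebesgue_rV R m)
  end.

Section smoothness.
Context {R : realType} (n : nat).
Implicit Types (f : 'rV[R]_n -> R) (Omega : set 'rV[R]_n).

Definition partial (i : 'I_n) f : 'rV[R]_n -> R :=
  fun x => 'D_(delta_mx ord0 i) f x.

Definition grad f : 'rV[R]_n -> 'rV[R]_n := fun x => \row_i partial i f x.

(* C^oo: every iterated partial derivative is differentiable everywhere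
   (hence continuous). *)
Definition smooth f :=
  forall (s : seq 'I_n) (x : 'rV[R]_n), differentiable (foldr partial f s) x.

(* C_c^oo(Omega), as functions on the whole space *)
Definition test_function Omega f :=
  [/\ smooth f, compact (closure [set x | f x != 0]) &
      closure [set x | f x != 0] `<=` Omega].

(* Near each boundary point, Omega is the sublevel set {rho < 0} of a smooth
   function with nonvanishing gradient. *)
Definition smooth_boundary Omega :=
  forall p, closure Omega p -> ~ Omega p ->
  exists rho, [/\ smooth rho, grad rho p != 0 &
                  \forall x \near p, Omega x <-> rho x < 0].

Definition bounded_smooth_domain Omega :=
  [/\ open Omega, connected Omega, Omega !=set0, bounded_set Omega &
      smooth_boundary Omega].

End smoothness.

Section sobolev.
Context {R : realType} (n : nat).
Local Notation mu := (lebesgue_rV R n).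
Implicit Types (Omega : set 'rV[R]_n).

(* Euclidean; the library norm on 'rV is the sup norm. *)
Definition dotv (v w : 'rV[R]_n) : R := \sum_i v ord0 i * w ord0 i.
Definition sqnorm (v : 'rV[R]_n) : R := dotv v v.

Definition L2fun Omega (f : 'rV[R]_n -> R) :=
  measurable_fun Omega f /\ mu.-integrable Omega (fun x => (f x ^+ 2)%:E).

(* An element of H^1(Omega) is represented by a pair (u, Du) of a function and
   its weak gradient, which is determined by u almost everywhere on Omega; the
   values outside Omega are irrelevant. Pairs are added and scaled
   componentwise. *)
Definition sobpair := (('rV[R]_n -> R) * ('rV[R]_n -> 'rV[R]_n))%type.
Implicit Types u v : sobpair.

Definition weak_gradient Omega (u : 'rV[R]_n -> R)
    (Du : 'rV[R]_n -> 'rV[R]_n) :=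
  forall phi, test_function Omega phi -> forall i,
    \int[mu]_(x in Omega) (u x * partial i phi x) =
    - \int[mu]_(x in Omega) (Du x ord0 i * phi x).

Definition H1 Omega : set sobpair :=
  [set u : sobpair |
    [/\ L2fun Omega u.1, forall i, L2fun Omega (fun x => u.2 x ord0 i) &
        weak_gradient Omega u.1 u.2]].

(* The closure of C_c^oo(Omega) in H^1(Omega) *)
Definition H10 Omega : set sobpair :=
  [set u : sobpair | H1 Omega u /\
    forall e : R, 0 < e -> exists2 phi, test_function Omega phi &
      (\int[mu]_(x in Omega)
         ((u.1 x - phi x) ^+ 2 + sqnorm (u.2 x - grad phi x))%:E < e%:E)%E].

(* u = 0 as an element of H^1(Omega) *)
Definition sob_zero Omega u := {ae mu, forall x, Omega x -> u.1 x = 0}.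

Definition crit_exp : R := 2 * n%:R / (n%:R - 2).

(* The inequality is between extended reals: no integrability of |u|^{2^*} is
   presupposed. *)
Definition sobolev_inequality (s : R) :=
  forall u, H1 setT u ->
    (s%:E * (\int[mu]_x (`|u.1 x| `^ crit_exp)%:E) `^ (2 / crit_exp)
     <= \int[mu]_x (sqnorm (u.2 x))%:E)%E.

Definition sobolev_const : R := sup [set s | sobolev_inequality s].

End sobolev.
Arguments crit_exp : clear implicits.
Arguments sobolev_const : clear implicits.

Section weighted_problem.
(* The space dimension is n.+1, so that the first coordinate exists. *)
Context {R : realType} (n : nat).
Local Notation mu := (lebesgue_rV R n.+1).
Local Notation sobpair := (@sobpair R n.+1).
Local Notation p := (crit_exp R n.+1).
Variable Theta : set 'rV[R]_n.+1.
Implicit Types u v : sobpair.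

Definition x1 (x : 'rV[R]_n.+1) : R := x ord0 ord0.

(* min and max over the closure of Theta, which is compact when Theta is
   bounded *)
Definition x1_min : R := inf [set x1 x | x in closure Theta].
Definition x1_max : R := sup [set x1 x | x in closure Theta].

Variable k : nat.

Definition energy (lam : R) u : R :=
  1 / 2 * \int[mu]_(x in Theta) (x1 x ^+ k * sqnorm (u.2 x))
  - lam / 2 * \int[mu]_(x in Theta) (x1 x ^+ k * u.1 x ^+ 2)
  - 1 / p * \int[mu]_(x in Theta) (x1 x ^+ k * `|u.1 x| `^ p).

(* J'(u) v for J = energy lam; J is of class C^1 on H^1_0(Theta), so its
   derivative applied to v is the directional derivative. *)
Definition denergy (lam : R) u v : R :=
  derive1 (fun t : R => energy lam (u + t *: v)) 0.

(* lam is an eigenvalue of -div(x_1^k grad u) = lam x_1^k u in Theta, u = 0 on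
   the boundary, in the weak sense. *)
Definition weighted_eigenvalue (lam : R) :=
  exists u, [/\ H10 Theta u, ~ sob_zero Theta u &
    forall v, H10 Theta v ->
      \int[mu]_(x in Theta) (x1 x ^+ k * dotv (u.2 x) (v.2 x)) =
      lam * \int[mu]_(x in Theta) (x1 x ^+ k * (u.1 x * v.1 x))].

(* The infimum over the eigenvalues is attained. *)
Definition lambda1 : \bar R :=
  ereal_inf [set lam%:E | lam in weighted_eigenvalue].

Definition nehari (lam : R) : set sobpair :=
  [set u | [/\ H10 Theta u, ~ sob_zero Theta u & denergy lam u u = 0]].

Definition ell (lam : R) : \bar R :=
  ereal_inf [set (energy lam u)%:E | u in nehari lam].

Definition kappa : R :=
  inf [set x1 x ^+ k | x in closure Theta] *
  (1 / n.+1%:R * sobolev_const R n.+1 `^ (n.+1%:R / 2)).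

Definition lambda0star : \bar R :=
  ereal_inf [set lam%:E | lam in
    [set lam : R | (lam%:E < lambda1)%E /\ (ell lam < kappa%:E)%E]].

End weighted_problem.

(* Main.v *)
Require Import Defs.
From HB Require Import structures.
From mathcomp Require Import all_boot all_order all_algebra.
From mathcomp Require Import all_classical all_reals all_analysis.
From mathcomp Require Import measurable_realfun.
From mathcomp Require Import ring lra.

Import Order.TTheory GRing.Theory Num.Theory.
Import numFieldNormedType.Exports.

Local Open Scope classical_set_scope.
Local Open Scope ring_scope.

Set Implicit Arguments.
Unset Strict Implicit.
Unset Printing Implicit Defensive.

(* Write N for the dimension, 2^* = 2N/(N-2), q = (N-2)/N, beta for the maximum
   of x_1 and K for the minimum of x_1^k. For u in H^1_0(Theta) put
   w = x_1^a u with a = k/2^*, extended by zero, so that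
   int |w|^{2^*} = int x_1^k |u|^{2^*}. The point is the inequality
     K^{2/N} int |grad w|^2 <= int x_1^k |grad u|^2 - lam int x_1^k u^2
   for lam <= k^2/(4 beta^2). It is a Hardy inequality: its integrand becomes
   pointwise nonnegative after adding the x_1-derivative of H(x_1) u^2, which
   integrates to zero. The function H comes from the one-dimensional
   supersolution e^{-kt/(2 beta)} ((2-q) beta - t), and the remaining condition
   is affine in the ratio K^{2/N} x_1^{-2k/N} in [0, 1], hence needs checking at
   the endpoints only, where it follows from q beta <= x_1 <= beta.
   With the Sobolev inequality for w, a point u of the Nehari manifold satisfies
   K^{2/N} S C^{2/2^*} <= C for C = int x_1^k |u|^{2^*}, whence
   J(u) = C/N >= K S^{N/2}/N = kappa. Both integral facts on u are proved for
   test functions (Fubini and the fundamental theorem of calculus) and extended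
   by density. *)

(** * Borel measurability and cubes in R^n *)

Section rV_borel.
Context {R : realType}.

Lemma measurable_cylinder {n} (A : 'I_n -> set R) :
  (forall i, measurable (A i)) ->
  measurable [set y : 'rV[R]_n | forall i, A i (y ord0 i)].
Proof.
move=> mA.
have -> : [set y : 'rV[R]_n | forall i, A i (y ord0 i)] =
    \bigcap_(i in [set: 'I_n]) ((fun y : 'rV[R]_n => y ord0 i) @^-1` A i).
  by apply/seteqP; split => [y h i _|y h i] /=; [exact: h|exact: (h i)].
apply: fin_bigcap_measurable; first exact: finite_finset.
move=> i _; rewrite -[X in measurable X]setTI.
by apply: measurable_coord => //.
Qed.

(** The measurable sets are generated by the coordinates, so openness is reduced to countably many
    boxes: [U] is the union of the sup-norm balls with rational centre and radius contained in it,
    and each such ball is a cylinder. *)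
Lemma open_measurable_rV {n} (U : set 'rV[R]_n) : open U -> measurable U.
Proof.
move=> oU.
pose B (p : 'rV[rat]_n * rat) : set 'rV[R]_n :=
  [set y | forall i, ball (ratr (p.1 ord0 i) : R) (ratr p.2) (y ord0 i)].
have -> : U = \bigcup_p (if `[< B p `<=` U >] then B p else set0).
  apply/seteqP; split => [x Ux|x [p _]]; last first.
    by case: ifPn => [/asboolP|//]; exact.
  have /nbhs_ballP[e /= e0 xeU] : nbhs x U by exact: open_nbhs_nbhs.
  (* A radius below e/2 keeps a box whose centre is within that radius of [x] inside the e-ball
     around [x]. *)
  have [r] := @rat_in_itvoo R 0 (e / 2) ltac:(by rewrite divr_gt0).
  rewrite in_itv/= => /andP[r0 re].
  have /choice[q qx] : forall i, exists q : rat, `|ratr q - x ord0 i| < ratr r.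
    move=> i; have [q] := @rat_in_itvoo R (x ord0 i - ratr r) (x ord0 i + ratr r)
      ltac:(by rewrite ltrBlDr -addrA ltrDl addr_gt0).
    by rewrite in_itv/= => h; exists q; rewrite ltr_distl.
  exists (\row_i q i, r) => //; case: ifPn => [_|/asboolPn].
    by move=> i /=; rewrite mxE; exact: qx.
  case=> y qy; apply: xeU; split => // i j; rewrite (ord1 i).
  apply: (@le_ball _ _ _ (ratr r + ratr r)).
    by rewrite [leRHS](splitr e) lerD// ltW.
  have qyj : ball (ratr (q j) : R) (ratr r) (y ord0 j).
    by have := qy j; rewrite /= mxE.
  by apply: ball_triangle qyj; exact/ball_sym/qx.
apply: countable_bigcupT_measurable; first exact: countableP.
move=> p; case: ifP => _ //.
apply: (@measurable_cylinder _ (fun i => ball (ratr (p.1 ord0 i) : R) (ratr p.2))) => i.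
exact: measurable_realfun.measurable_ball.
Qed.

Lemma continuous_measurable_rV {n} (D : set 'rV[R]_n) (f : 'rV[R]_n -> R) :
  open D -> {in D, continuous f} -> measurable_fun D f.
Proof.
move=> oD cf; apply: (measurability _ (measurable_realfun.RGenOpens.measurableE R)).
move=> _ [_ [a [b ->] <-]]; apply: open_measurable_rV.
move: cf; rewrite -(continuous_open_subspace f oD) => /continuousP cf.
have /open_subspaceP[V oV VD] := cf _ (@interval_open R (BRight a) (BLeft b) isT isT).
by rewrite setIC -VD; exact: openI.
Qed.

Lemma continuous_measurableT_rV {n} (f : 'rV[R]_n -> R) :
  continuous f -> measurable_fun setT f.
Proof.
by move=> cf; apply: continuous_measurable_rV => //; exact: openT.
Qed.

(** The coordinatewise form makes the cube split as an interval times a lower-dimensional cube,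
    which suits the recursive definition of the measure. *)
Definition cube n (M : R) : set 'rV[R]_n :=
  [set x | forall i, x ord0 i \in `[- M, M]].
Arguments cube n M : clear implicits.

Lemma measurable_cube n (M : R) : measurable (cube n M).
Proof.
apply: (@measurable_cylinder _ (fun=> `[- M, M]%classic)) => _.
exact: measurable_itv.
Qed.

Lemma cons_rV_cube n (M : R) :
  @cons_rV R n @^-1` cube n.+1 M = `[- M, M]%classic `*` cube n M.
Proof.
apply/seteqP; split => [[t x] /= h|[t x] /= [h1 h2] i].
  split => [|i]; first by have := h ord0; rewrite cons_rV0.
  by have := h (lift ord0 i); rewrite cons_rVS.
case: (unliftP ord0 i) => [j ->|->]; first by rewrite cons_rVS; exact: h2.
by rewrite cons_rV0.
Qed.

Lemma lebesgue_cube_lty n (M : R) : (lebesgue_rV R n (cube n M) < +oo)%E.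
Proof.
elim: n => [|n IH]; first by rewrite /= diracE ltry.
rewrite /= /lebesgue_cons /pushforward cons_rV_cube.
rewrite product_measure1E//; last exact: measurable_cube.
have I : (@lebesgue_measure R [set` `[- M, M]%R] < +oo)%E.
  by rewrite lebesgue_measure_itv/=; case: ifP => // _; exact: ltry.
by apply: lte_mul_pinfty => //; rewrite ge0_fin_numE.
Qed.

Lemma bounded_sub_cube {n} (D : set 'rV[R]_n) :
  bounded_set D -> exists M, D `<=` cube n M.
Proof.
move=> [M [_ /(_ (M + 1))]]; rewrite ltrDl => /(_ ltr01) DM; exists (M + 1).
move=> x /DM /= xM i; rewrite in_itv/= -ler_norml; apply: le_trans xM.
by rewrite [leRHS]/Num.norm/= mx_normrE (le_bigmax _ (fun p => `|x p.1 p.2|) (ord0, i)).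
Qed.

Lemma bounded_lebesgue_rV_lty {n} (D : set 'rV[R]_n) :
  measurable D -> bounded_set D -> (lebesgue_rV R n D < +oo)%E.
Proof.
move=> mD /bounded_sub_cube[M DM].
apply: le_lt_trans (lebesgue_cube_lty n M); apply: le_measure; rewrite ?inE//.
exact: measurable_cube.
Qed.

End rV_borel.
Arguments cube {R} n M.

(** * Vanishing integrals of compactly supported derivatives *)

Section integration_by_parts.
Context {R : realType}.

Lemma continuous_rV {T : topologicalType} {n} (f : T -> 'rV[R]_n) :
  (forall i, continuous (fun t => f t ord0 i)) -> continuous f.
Proof.
move=> cf t; apply/cvg_ballP => e e0.
have : \forall s \near t, forall i, ball (f t ord0 i) e (f s ord0 i).
  by apply: filter_forall => i; move/cvg_ballP : (cf i t); exact.
by apply: filterS => s h; split => // i j; rewrite (ord1 i).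
Qed.

Lemma continuous_cons_rVl {n} (x : 'rV[R]_n) :
  continuous (fun t : R => cons_rV (t, x)).
Proof.
apply: continuous_rV => i; case: (unliftP ord0 i) => [j ->|->].
  by under eq_fun do rewrite cons_rVS; exact: cst_continuous.
by under eq_fun do rewrite cons_rV0.
Qed.

Lemma continuous_cons_rVr {n} (t : R) :
  continuous (fun x : 'rV[R]_n => cons_rV (t, x)).
Proof.
apply: continuous_rV => i; case: (unliftP ord0 i) => [j ->|->].
  by under eq_fun do rewrite cons_rVS; exact: coord_continuous.
by under eq_fun do rewrite cons_rV0; exact: cst_continuous.
Qed.

Lemma compact_cube n (M : R) : compact (cube n M).
Proof.
apply: (@rV_compact R n (fun=> `[- M, M]%classic)) => _.
exact: segment_compact.
Qed.

Lemma compact_continuous_bounded {T : topologicalType} {A : set T} {f : T -> R} :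
  compact A -> {within A, continuous f} ->
  exists2 C : R, 0 <= C & forall x, A x -> `|f x| <= C.
Proof.
move=> cA cf; have [A0|/set0P/negP] := pselect (A !=set0); last first.
  by rewrite negbK => /eqP ->; exists 0.
have cnf : {within A, continuous (fun x => `|f x|)}.
  by move=> x; apply: cvg_norm; exact: cf.
have [c cinA h] := compact_EVT_max A0 cA cnf.
by exists `|f c| => // x Ax; apply: h; rewrite inE.
Qed.

Lemma integrable_continuous_rV {n} (f : 'rV[R]_n -> R) (M : R) :
  continuous f -> (forall x, ~ cube n M x -> f x = 0) ->
  (lebesgue_rV R n).-integrable setT (EFin \o f).
Proof.
move=> cf f0.
have [C C0 fC] := compact_continuous_bounded (@compact_cube n M)
  (continuous_subspaceT cf).
have mf : measurable_fun setT f by exact: continuous_measurableT_rV.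
have -> : EFin \o f = (EFin \o f) \_ (cube n M).
  apply/funext => x; rewrite patchE; case: ifPn => // /negP.
  by rewrite inE /= => /f0 ->.
apply: (integrable_mkcond _ (@measurable_cube R n M)).1.
apply: measurable_bounded_integrable; first exact: measurable_cube.
- exact: lebesgue_cube_lty.
- exact: measurable_funTS.
- exists C; split; first exact: ger0_real.
  by move=> x Cx y /= /fC yC; exact: le_trans yC (ltW Cx).
Qed.

Lemma integral_derive_compact (F f : R -> R) (M : R) :
  continuous f -> (forall t : R, is_derive t (1 : R) F (f t)) ->
  (forall t, t \notin `[- M, M] -> F t = 0 /\ f t = 0) ->
  (\int[lebesgue_measure]_t (f t)%:E = 0)%E.
Proof.
move=> cf dF F0.
(* Strictly larger than [M] and positive even for negative [M]: the interval is nondegenerate and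
   [F] vanishes at both of its endpoints. *)
pose M1 := `|M| + 1.
have MM1 : M < M1 by rewrite /M1 (le_lt_trans (ler_norm M))// ltrDl.
have M1_gt0 : 0 < M1 by rewrite ltr_wpDl.
have F1 t : M1 <= `|t| -> F t = 0 /\ f t = 0.
  move=> M1t; apply: F0; rewrite in_itv/= -ler_norml -ltNge.
  exact: lt_le_trans M1t.
have -> : (fun t => (f t)%:E) = (EFin \o f) \_ `[- M1, M1].
  apply/funext => x; rewrite patchE; case: ifPn => // /negP.
  rewrite inE /= in_itv/= -ler_norml => /negP; rewrite -ltNge => /ltW.
  by move=> /F1[_ ->].
rewrite -integral_mkcond (@continuous_FTC2 _ f F)//.
- rewrite (F1 _ _).1 ?(F1 _ _).1 ?subee// ?normrN ger0_norm//; exact: ltW.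
- by rewrite gtrN.
- exact: continuous_subspaceT.
- have cF : continuous F.
    by move=> x; apply/differentiable_continuous/derivable1_diffP.
  split => [x _| |]; first exact: ex_derive.
    exact/cvg_at_right_filter/cF.
  exact/cvg_at_left_filter/cF.
- by move=> x _; rewrite derive1E derive_val.
Qed.

(** The two difference quotients are the same function of the increment, so a directional derivative
    can be handled by one-variable calculus. *)
Lemma is_derive_line {V : normedModType R} (f : V -> R) (x v : V) (df : R) :
  is_derive x v f df <-> is_derive (0 : R) (1 : R) (fun s => f (x + s *: v)) df.
Proof.
have E : (fun h : R => h^-1 *: ((f \o shift x) (h *: v) - f x)) =
    (fun h : R => h^-1 *: (((fun s : R => f (x + s *: v)) \o shift (0 : R))
      (h *: (1 : R)) - f (x + (0 : R) *: v))).
  apply/funext => h; rewrite /= scale0r !addr0; congr (_ *: (f _ - _)).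
  by rewrite addrC [h *: 1]mulr1.
by split=> -[dv dE]; split;
  rewrite /derivable /derive -?E// /derivable /derive ?E//.
Qed.

Lemma cons_rV_addZ {n} (t s : R) (x : 'rV[R]_n) (c : R) (y : 'rV[R]_n) :
  cons_rV (t, x) + s *: cons_rV (c, y) = cons_rV (t + s * c, x + s *: y).
Proof.
apply/rowP => i; case: (unliftP ord0 i) => [j ->|->].
  by rewrite [LHS]mxE [X in _ + X]mxE !cons_rVS /= !mxE.
by rewrite [LHS]mxE [X in _ + X]mxE !cons_rV0.
Qed.

Lemma delta_mx_cons0 n : delta_mx ord0 ord0 = cons_rV (1, 0) :> 'rV[R]_n.+1.
Proof.
apply/rowP => i; case: (unliftP ord0 i) => [j ->|->].
  by rewrite cons_rVS !mxE.
by rewrite cons_rV0 !mxE !eqxx.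
Qed.

Lemma delta_mx_consS {n} (j : 'I_n) :
  delta_mx ord0 (lift ord0 j) = cons_rV (0, delta_mx ord0 j) :> 'rV[R]_n.+1.
Proof.
apply/rowP => i; case: (unliftP ord0 i) => [l ->|->].
  by rewrite cons_rVS !mxE (inj_eq (@lift_inj _ _)).
by rewrite cons_rV0 !mxE.
Qed.

(** Fubini through the push-forward definition of the measure. Both orders are recorded, because the
    direction of a derivative decides which variable has to be integrated first. *)
Lemma integral_lebesgue_cons {n} (f : 'rV[R]_n.+1 -> R) (M : R) :
  continuous f -> (forall x, ~ cube n.+1 M x -> f x = 0) ->
  (\int[lebesgue_rV R n.+1]_x (f x)%:E =
     \int[lebesgue_measure]_t \int[lebesgue_rV R n]_x (f (cons_rV (t, x)))%:E /\
   \int[lebesgue_rV R n.+1]_x (f x)%:E =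
     \int[lebesgue_rV R n]_x \int[lebesgue_measure]_t (f (cons_rV (t, x)))%:E)%E.
Proof.
move=> cf f0; have intf := integrable_continuous_rV cf f0.
have mf := measurable_int _ intf.
have intfc : (@lebesgue_measure R \x lebesgue_rV R n)%E.-integrable
    setT (EFin \o f \o @cons_rV R n).
  apply/integrableP; split.
    exact: (measurableT_comp mf (@measurable_cons_rV R n)).
  move/integrableP : intf => [_]; rewrite /= /lebesgue_cons.
  rewrite ge0_integral_pushforward//; first exact: measurable_cons_rV.
  by apply/measurable_EFinP; apply: measurableT_comp => //; exact/measurable_EFinP.
have -> : (\int[lebesgue_rV R n.+1]_x (f x)%:E =
    \int[lebesgue_measure \x lebesgue_rV R n]_z (EFin \o f \o @cons_rV R n) z)%E.
  rewrite /= /lebesgue_cons (integral_pushforward (@measurable_cons_rV R n) mf)//.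
by split; [rewrite -integral12_prod_meas1|rewrite -integral21_prod_meas1].
Qed.

(** Induction on the dimension: a derivative in the first variable is integrated along that variable
    first, any other one is a derivative of the slices with the first variable frozen.
    Differentiability is assumed only along lines, a form that passes to slices. *)
Lemma integral_partial0 {n} (i : 'I_n) (F F' : 'rV[R]_n -> R) (M : R) :
  continuous F' ->
  (forall x, is_derive (0 : R) (1 : R)
    (fun s => F (x + s *: delta_mx ord0 i)) (F' x)) ->
  (forall x, ~ cube n M x -> F x = 0 /\ F' x = 0) ->
  (\int[lebesgue_rV R n]_x (F' x)%:E = 0)%E.
Proof.
elim: n i F F' => [[]//|n IH] i F F' cF' dF F0.
have [E1 E2] := integral_lebesgue_cons cF' (fun x h => (F0 x h).2).
have cubeP t x : cube n.+1 M (cons_rV (t, x)) <-> t \in `[- M, M] /\ cube n M x.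
  have /(congr1 (fun A => A (t, x))) /= := cons_rV_cube n M.
  by move=> <-.
case: (unliftP ord0 i) => [j ij|i0].
  rewrite E1 integral0_eq// => t _.
  apply: (IH j (fun x => F (cons_rV (t, x)))).
  - move=> x; apply: continuous_comp; first exact: continuous_cons_rVr.
    exact: cF'.
  - move=> x; have := dF (cons_rV (t, x)); rewrite ij delta_mx_consS.
    by under eq_fun do rewrite cons_rV_addZ mulr0 addr0.
  - by move=> x h; apply: F0 => /cubeP[].
rewrite E2 integral0_eq// => x _.
apply: (@integral_derive_compact (fun t => F (cons_rV (t, x))) _ M).
- move=> t; apply: continuous_comp; first exact: continuous_cons_rVl.
  exact: cF'.
- move=> t; have := dF (cons_rV (t, x)); rewrite i0 delta_mx_cons0.
  under eq_fun do rewrite cons_rV_addZ scaler0 addr0.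
  by move/(@is_derive_line R (fun t => F (cons_rV (t, x)))).
- by move=> t /negP h; apply: F0 => /cubeP[/h].
Qed.

End integration_by_parts.

(** * Test functions and their supports *)

Section test_functions.
Context {R : realType} {n : nat}.
Implicit Types (phi : 'rV[R]_n -> R) (Omega : set 'rV[R]_n).

Lemma smooth_differentiable phi x : smooth phi -> differentiable phi x.
Proof. by move=> /(_ [::] x). Qed.

Lemma smooth_partial_differentiable phi i x :
  smooth phi -> differentiable (partial i phi) x.
Proof. by move=> /(_ [:: i] x). Qed.

Lemma smooth_continuous phi : smooth phi -> continuous phi.
Proof. by move=> s x; exact/differentiable_continuous/smooth_differentiable. Qed.

Lemma smooth_partial_continuous phi i : smooth phi -> continuous (partial i phi).
Proof.
by move=> s x; exact/differentiable_continuous/smooth_partial_differentiable.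
Qed.

Lemma smooth_is_derive phi i x :
  smooth phi -> is_derive x (delta_mx ord0 i) phi (partial i phi x).
Proof.
by move=> s; apply: DeriveDef => //; exact/diff_derivable/smooth_differentiable.
Qed.

Lemma near_support phi x : ~ closure [set y | phi y != 0] x ->
  \forall y \near x, phi y = 0.
Proof.
move=> xK.
have oK : open (~` closure [set y | phi y != 0]).
  exact/closed_openC/closed_closure.
have := open_nbhs_nbhs (conj oK xK); apply: filterS => y yK.
by apply/eqP; apply: contra_notT yK => y0; exact: subset_closure.
Qed.

Lemma near_support_partial phi i x : ~ closure [set y | phi y != 0] x ->
  \forall y \near x, partial i phi y = 0.
Proof.
move=> /near_support/nbhs_interior; apply: filterS => y yK.
rewrite /partial (@near_eq_derive _ _ _ _ (cst 0)) ?derive_cst//.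
Qed.

Lemma closure_compact Omega : bounded_set Omega -> compact (closure Omega).
Proof.
move=> /bounded_sub_cube[M OM].
apply: (@subclosed_compact _ (closure Omega) (cube n M)).
- exact: closed_closure.
- exact: compact_cube.
- rewrite (closure_id (cube n M)).1; first exact: closure_subset.
  by apply: compact_closed; [exact: norm_hausdorff|exact: compact_cube].
Qed.

End test_functions.

(** * Products of a weight in x_1 with test functions *)

Section weighted_product.
Context {R : realType} {n : nat}.
Variables (Theta : set 'rV[R]_n.+1) (h h' : R -> R).
Hypothesis oTheta : open Theta.
Hypothesis bTheta : bounded_set Theta.
Hypothesis dh : forall x : 'rV[R]_n.+1, closure Theta x ->
  is_derive (x1 x) (1 : R) h (h' (x1 x)).
Hypothesis ch' : forall x : 'rV[R]_n.+1, closure Theta x ->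
  {for x1 x, continuous h'}.
Local Notation mu := (lebesgue_rV R n.+1).

Lemma x1_continuous : continuous (@x1 R n).
Proof. exact: coord_continuous. Qed.

Lemma continuous_h_x1 x : closure Theta x -> {for x, continuous (h \o @x1 R n)}.
Proof.
move=> /dh xh; apply: continuous_comp; first exact: x1_continuous.
exact/differentiable_continuous/derivable1_diffP.
Qed.

Lemma continuous_h'_x1 x :
  closure Theta x -> {for x, continuous (h' \o @x1 R n)}.
Proof.
by move=> /ch' xh; apply: continuous_comp => //; exact: x1_continuous.
Qed.

(** The i-th partial derivative of h(x_1) phi chi by the product rule; the weight contributes only
    in the direction of x_1. *)
Definition weighted_partial (phi chi : 'rV[R]_n.+1 -> R) (i : 'I_n.+1) x : R :=
  (i == ord0)%:R * h' (x1 x) * (phi x * chi x) +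
  h (x1 x) * (partial i phi x * chi x + phi x * partial i chi x).

Lemma is_derive_weight i x : closure Theta x ->
  is_derive x (delta_mx ord0 i) (h \o @x1 R n) ((i == ord0)%:R * h' (x1 x)).
Proof.
move=> /dh xh; apply/is_derive_line.
have -> : (fun s : R => (h \o @x1 R n) (x + s *: delta_mx ord0 i)) =
    h \o (fun s : R => x1 x + s * (i == ord0)%:R).
  by apply/funext => s /=; rewrite /x1 !mxE eq_sym.
rewrite mulrC; apply: is_derive1_comp; first by rewrite mul0r addr0.
rewrite (_ : (fun s : R => _) = cst (x1 x) + id * cst (i == ord0)%:R)//.
apply: is_derive_eq.
by rewrite /cst/= scaler0 !add0r [LHS]mulr1.
Qed.

Lemma is_derive_weighted_product phi chi i x :
  test_function Theta phi -> smooth chi ->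
  is_derive x (delta_mx ord0 i) (fun x => h (x1 x) * phi x * chi x)
    (weighted_partial phi chi i x).
Proof.
move=> [sphi _ KT] schi.
(* The weight is controlled only on the closure of [Theta]. Off the support of [phi] the product
   vanishes near [x], whatever the weight does there. *)
have [Kx|nKx] := pselect (closure [set y | phi y != 0] x); last first.
  have p0 := near_support nKx; have p0' := near_support_partial i nKx.
  have -> : weighted_partial phi chi i x = 0.
    rewrite /weighted_partial (nbhs_singleton p0) (nbhs_singleton p0').
    by rewrite !(mul0r, mulr0, addr0).
  apply: (@near_eq_is_derive _ _ _ (cst 0)).
    by near=> y; rewrite /= (near p0 y)// mulr0 mul0r.
have cx : closure Theta x by exact/subset_closure/KT.
have d1 := is_derive_weight i cx.
have d2 := smooth_is_derive i x sphi.
have d3 := smooth_is_derive i x schi.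
apply: is_derive_eq (is_deriveM (is_deriveM d1 d2) d3) _.
rewrite /weighted_partial /GRing.scale/=.
rewrite (_ : ((h \o @x1 R n) * phi) x = h (x1 x) * phi x)//; ring.
Unshelve. all: by end_near. Qed.

Lemma continuous_weighted_partial phi chi i :
  test_function Theta phi -> smooth chi ->
  continuous (weighted_partial phi chi i).
Proof.
move=> [sphi _ KT] schi x.
have [Kx|nKx] := pselect (closure [set y | phi y != 0] x); last first.
  have p0 := near_support nKx; have p0' := near_support_partial i nKx.
  have E : \forall y \near x, 0 = weighted_partial phi chi i y.
    near=> y; rewrite /weighted_partial (near p0 y)// (near p0' y)//.
    by rewrite !(mul0r, mulr0, addr0).
  rewrite /continuous_at -(nbhs_singleton E).
  by apply: cvg_trans; [exact: (near_eq_cvg E)|exact: cvg_cst].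
have cx : closure Theta x by exact/subset_closure/KT.
have c1 := continuous_h_x1 cx; have c2 := continuous_h'_x1 cx.
have c3 := @smooth_continuous _ _ _ sphi x.
have c4 := @smooth_continuous _ _ _ schi x.
have c5 := @smooth_partial_continuous _ _ _ i sphi x.
have c6 := @smooth_partial_continuous _ _ _ i schi x.
exact: (cvgD (cvgM (cvgM (cvg_cst ((i == ord0)%:R : R)) c2) (cvgM c3 c4))
  (cvgM c1 (cvgD (cvgM c5 c4) (cvgM c3 c6)))).
Unshelve. all: by end_near. Qed.

Lemma weighted_partial_out phi chi i x : test_function Theta phi -> ~ Theta x ->
  h (x1 x) * phi x * chi x = 0 /\ weighted_partial phi chi i x = 0.
Proof.
move=> [_ _ KT] nTx; have nKx : ~ closure [set y | phi y != 0] x.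
  by move=> /KT.
have p0 := near_support nKx; have p0' := near_support_partial i nKx.
rewrite /weighted_partial (nbhs_singleton p0) (nbhs_singleton p0').
by split; rewrite !(mul0r, mulr0, add0r).
Qed.

Lemma integrable_weighted_partial phi chi i :
  test_function Theta phi -> smooth chi ->
  mu.-integrable Theta (EFin \o weighted_partial phi chi i).
Proof.
move=> tphi schi; have [M TM] := bounded_sub_cube bTheta.
apply: (@integrableS _ _ _ _ setT) => //; first exact: open_measurable_rV.
apply: (@integrable_continuous_rV _ _ _ M).
  exact: continuous_weighted_partial.
move=> x nx; apply: (weighted_partial_out _ _ tphi _).2 => //.
by move=> /TM.
Qed.

(** The compact support of [phi] in [Theta] lets the integral be taken over the whole space, where
    [integral_partial0] applies; [chi] may be any smooth function. *)
Lemma integral_weighted_partial phi chi i :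
  test_function Theta phi -> smooth chi ->
  \int[mu]_(x in Theta) weighted_partial phi chi i x = 0.
Proof.
move=> tphi schi; have [M TM] := bounded_sub_cube bTheta.
rewrite /Rintegral integral_mkcond.
rewrite (_ : _ \_ Theta = EFin \o weighted_partial phi chi i); last first.
  apply/funext => x; rewrite patchE; case: ifPn => // /negP.
  by rewrite inE => /(weighted_partial_out chi i tphi)[_ /= ->].
have -> : (\int[mu]_x (EFin \o weighted_partial phi chi i) x = 0)%E.
  apply: (@integral_partial0 _ _ i (fun x => h (x1 x) * phi x * chi x) _ M).
  - exact: continuous_weighted_partial.
  - move=> x; have := is_derive_weighted_product i x tphi schi.
    by move=> /is_derive_line.
  - by move=> x nx; apply: weighted_partial_out => // /TM.
by [].
Qed.

End weighted_product.

(** * Square-integrable functions on a set of finite measure *)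

Section L2.
Context {R : realType} {n : nat}.
Local Notation mu := (lebesgue_rV R n).
Variable D : set 'rV[R]_n.
Hypothesis mD : measurable D.
Hypothesis muD : (mu D < +oo)%E.
Implicit Types f g b : 'rV[R]_n -> R.

Lemma integrable_bounded_mul b f (C : R) :
  measurable_fun D b -> (forall x, D x -> `|b x| <= C) ->
  mu.-integrable D (EFin \o f) ->
  mu.-integrable D (fun x => (b x * f x)%:E).
Proof.
move=> mb bC intf; apply: (@integrableMr _ _ _ _ _ mD b (EFin \o f)) => //.
exists C; split; first exact: num_real.
by move=> y Cy z /= /bC bz; exact: le_trans bz (ltW Cy).
Qed.

Lemma integrable_RD f g : mu.-integrable D (EFin \o f) ->
  mu.-integrable D (EFin \o g) ->
  mu.-integrable D (EFin \o (fun x => f x + g x)).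
Proof. exact: integrableD. Qed.

Lemma integrable_RB f g : mu.-integrable D (EFin \o f) ->
  mu.-integrable D (EFin \o g) ->
  mu.-integrable D (EFin \o (fun x => f x - g x)).
Proof. by move=> f1 g1; apply: eq_integrable (integrableB mD f1 g1). Qed.

Lemma integrable_RZl (c : R) f : mu.-integrable D (EFin \o f) ->
  mu.-integrable D (EFin \o (fun x => c * f x)).
Proof. exact: integrableZl. Qed.

Lemma integrable_cst (c : R) : mu.-integrable D (fun=> c%:E).
Proof.
apply: (@measurable_bounded_integrable _ _ _ _ (cst c)) => //.
exists `|c|; split; first exact: num_real.
by move=> y cy x _ /=; exact: ltW.
Qed.

(** Domination by |f g| <= f^2 + g^2. *)
Lemma integrable_L2_mul f g : L2fun D f -> L2fun D g ->
  mu.-integrable D (fun x => (f x * g x)%:E).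
Proof.
move=> [mf f2] [mg g2].
apply: (le_integrable mD _ _ (integrableD mD f2 g2)).
  by apply/measurable_EFinP; exact: measurable_funM.
move=> x Dx; rewrite /= lee_fin [leRHS]ger0_norm ?addr_ge0 ?sqr_ge0//.
rewrite ler_norml; have := sqr_ge0 (f x - g x); have := sqr_ge0 (f x + g x).
have := sqr_ge0 (f x); have := sqr_ge0 (g x).
move: (f x) (g x) => a c; nra.
Qed.

Lemma L2fun_bounded_mul b f (C : R) :
  measurable_fun D b -> (forall x, D x -> `|b x| <= C) ->
  L2fun D f -> L2fun D (fun x => b x * f x).
Proof.
move=> mb bC [mf f2]; split; first exact: measurable_funM.
under eq_fun do rewrite exprMn.
apply: (@integrable_bounded_mul (fun x => b x ^+ 2) (fun x => f x ^+ 2) (C ^+ 2)) => //.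
  exact: measurable_funX.
move=> x Dx; rewrite normrX lerXn2r// ?nnegrE// ?bC//.
exact: le_trans (bC _ Dx).
Qed.

Lemma L2fun_bounded b (C : R) :
  measurable_fun D b -> (forall x, D x -> `|b x| <= C) -> L2fun D b.
Proof.
move=> mb bC; split => //.
apply: measurable_bounded_integrable => //; first exact: measurable_funX.
exists (C ^+ 2); split; first exact: num_real.
move=> y Cy x Dx /=; apply: le_trans (ltW Cy); rewrite normrX lerXn2r ?nnegrE//.
  exact: le_trans (bC _ Dx).
exact: bC.
Qed.

Lemma L2funD f g : L2fun D f -> L2fun D g -> L2fun D (fun x => f x + g x).
Proof.
move=> Lf Lg; split; first exact: measurable_funD Lf.1 Lg.1.
have i1 := integrableD mD (integrableD mD Lf.2 Lg.2)
  (integrableZl mD 2 (integrable_L2_mul Lf Lg)).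
apply: eq_integrable i1 => // x _ /=.
by rewrite -EFinM -!EFinD; congr EFin; rewrite sqrrD; ring.
Qed.

Lemma L2funB f g : L2fun D f -> L2fun D g -> L2fun D (fun x => f x - g x).
Proof.
move=> Lf Lg; apply: L2funD => //.
have -> : (fun x => - g x) = (fun x => (-1) * g x).
  by apply/funext => x; rewrite mulN1r.
by apply: (@L2fun_bounded_mul (cst (-1)) g 1) => // x _; rewrite normrN1.
Qed.

Lemma integrable_sqnorm (v : 'rV[R]_n -> 'rV[R]_n) :
  (forall i, L2fun D (fun x => v x ord0 i)) ->
  mu.-integrable D (fun x => (sqnorm (v x))%:E).
Proof.
move=> Lv; rewrite /sqnorm /dotv.
under eq_fun do rewrite -sumEFin.
by apply: integrable_sum => // i _; exact: integrable_L2_mul.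
Qed.

(** The density principle: an identity saying that an integral vanishes passes from approximants [r]
    to [f] if the error is dominated by some [g] of integral at most e K, with [K] independent of
    [e]. *)
Lemma Rintegral_approx0 f (K : R) : mu.-integrable D (EFin \o f) ->
  (forall e : R, 0 < e <= 1 -> exists r g : 'rV[R]_n -> R,
    [/\ mu.-integrable D (EFin \o r) /\ \int[mu]_(x in D) r x = 0,
        mu.-integrable D (EFin \o g),
        forall x, D x -> `|f x - r x| <= g x &
        \int[mu]_(x in D) g x <= e * K]) ->
  \int[mu]_(x in D) f x = 0.
Proof.
move=> intf H.
have K0 e : 0 < e <= 1 -> `|\int[mu]_(x in D) f x| <= e * K.
  move=> /H[r [g [[intr r0] intg fr gK]]]; apply: le_trans gK.
  rewrite -[X in `|X|]subr0 -r0 -RintegralB//.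
  have intfr : mu.-integrable D (EFin \o (fun x => f x - r x)).
    by apply: eq_integrable (integrableB mD intf intr) => //.
  apply: le_trans (le_normr_Rintegral mD intfr) _.
  by apply: le_Rintegral => //; exact: integrable_norm.
have K00 : 0 <= K.
  by have := K0 1; rewrite ltr01 lexx mul1r => /(_ isT); exact: le_trans.
apply/eqP; rewrite -normr_le0; apply/ler_addgt0Pl => e e0; rewrite addr0.
(* The denominator K + 1 is positive even if K = 0; the minimum respects the restriction to
   parameters at most 1. *)
pose e1 := Num.min 1 (e / (K + 1)).
have e10 : 0 < e1 by rewrite lt_min ltr01 divr_gt0// ltr_wpDl.
apply: le_trans (K0 e1 _) _; first by rewrite e10 ge_min lexx.
have : e1 <= e / (K + 1) by rewrite ge_min lexx orbT.
rewrite ler_pdivlMr ?ltr_wpDl//; apply: le_trans.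
by rewrite mulrDr mulr1 lerDl ltW.
Qed.

End L2.

Lemma sqnorm_ge0 {R : realType} {n} (v : 'rV[R]_n) : 0 <= sqnorm v.
Proof. by apply: sumr_ge0 => i _; rewrite -expr2 sqr_ge0. Qed.

Lemma sqr_coord_le_sqnorm {R : realType} {n} (v : 'rV[R]_n) i :
  v ord0 i ^+ 2 <= sqnorm v.
Proof.
rewrite /sqnorm /dotv (bigD1 i)//= -expr2 lerDl.
by apply: sumr_ge0 => j _; rewrite -expr2 sqr_ge0.
Qed.

Lemma L2fun_continuous {R : realType} {n} (Omega : set 'rV[R]_n) (b : 'rV[R]_n -> R) :
  open Omega -> bounded_set Omega -> continuous b -> L2fun Omega b.
Proof.
move=> oO bO cb; have mO := open_measurable_rV oO.
have [C _ bC] := compact_continuous_bounded (closure_compact bO)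
  (continuous_subspaceT cb).
apply: (@L2fun_bounded _ _ _ mO (bounded_lebesgue_rV_lty mO bO) b C).
  by apply: measurable_funTS; exact: continuous_measurableT_rV.
by move=> x /subset_closure/bC.
Qed.

(** On a bounded set, a test function and its gradient are square integrable, so the squared H^1
    distance is integrable and its bound becomes one between real numbers. *)
Lemma H10_approx {R : realType} {n} (Omega : set 'rV[R]_n) (u : @sobpair R n) (e : R) :
  open Omega -> bounded_set Omega -> H10 Omega u -> 0 < e ->
  exists2 phi, test_function Omega phi &
    let d x := (u.1 x - phi x) ^+ 2 + sqnorm (u.2 x - grad phi x) in
    (lebesgue_rV R n).-integrable Omega (EFin \o d) /\
    \int[lebesgue_rV R n]_(x in Omega) d x <= e.
Proof.
move=> oO bO [[Lu LDu _] H] e0; have mO := open_measurable_rV oO.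
have muO := bounded_lebesgue_rV_lty mO bO.
have [phi tphi de] := H _ e0; exists phi => //= .
have [sphi _ _] := tphi.
set d := (X in EFin \o X).
have intd : (lebesgue_rV R n).-integrable Omega (EFin \o d).
  apply: integrable_RD => //.
  - have Lphi : L2fun Omega phi.
      by apply: L2fun_continuous => //; exact: smooth_continuous.
    exact: (L2funB mO Lu Lphi).2.
  apply: integrable_sqnorm => // i.
  have -> : (fun x => (u.2 x - grad phi x) ord0 i) =
      (fun x => u.2 x ord0 i - partial i phi x).
    by apply/funext => x; rewrite !mxE.
  apply: L2funB => //; apply: L2fun_continuous => //.
  exact: smooth_partial_continuous.
split => //; rewrite -lee_fin fineK; first exact: ltW.
exact: integrable_fin_num.
Qed.

(** With a = u - phi and c = v - psi the two left-hand sides are |u^2 - phi^2| and 2 |u v - phi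
    psi|. Young's inequality with weight [e] bounds the cross terms, and e <= 1 absorbs the squares
    of [a] and [c] into the e^-1 term. *)
Lemma weighted_young_bound {R : realFieldType} (e u v a c d : R) :
  0 < e -> e <= 1 -> a ^+ 2 + c ^+ 2 <= d ->
  `|2 * u * a - a ^+ 2| <= 2 * e * (u ^+ 2 + v ^+ 2) + 4 * e^-1 * d /\
  `|2 * (u * c + v * a - a * c)| <= 2 * e * (u ^+ 2 + v ^+ 2) + 4 * e^-1 * d.
Proof.
move=> e0 e1 acd; have ev : 1 <= e^-1 by rewrite invf_ge1.
have Y (x y : R) : 2 * `|x * y| <= e * x ^+ 2 + e^-1 * y ^+ 2.
  rewrite -(ler_pM2l e0) mulrDr mulVKf ?gt_eqF// normrM.
  have := sqr_ge0 (e * `|x| - `|y|).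
  by rewrite -[x ^+ 2]real_normK ?num_real// -[y ^+ 2]real_normK ?num_real//; nra.
have Y1 (x y : R) : 2 * `|x * y| <= x ^+ 2 + y ^+ 2.
  have := sqr_ge0 (`|x| - `|y|); rewrite normrM.
  by rewrite -[x ^+ 2]real_normK ?num_real// -[y ^+ 2]real_normK ?num_real//; nra.
have a2 := sqr_ge0 a; have c2 := sqr_ge0 c.
have u2 : 0 <= e * u ^+ 2 by rewrite mulr_ge0 ?sqr_ge0 ?ltW.
have v2 : 0 <= e * v ^+ 2 by rewrite mulr_ge0 ?sqr_ge0 ?ltW.
have ea : e^-1 * a ^+ 2 + e^-1 * c ^+ 2 <= e^-1 * d.
  by rewrite -mulrDr ler_pM2l ?invr_gt0.
have ea0 : a ^+ 2 <= e^-1 * a ^+ 2 by rewrite ler_peMl.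
have ec0 : c ^+ 2 <= e^-1 * c ^+ 2 by rewrite ler_peMl.
have h1 := Y u a; have h2 := Y u c; have h3 := Y v a; have h4 := Y1 a c.
split.
  apply: le_trans (ler_normB _ _) _.
  by rewrite -mulrA normrM (@ger0_norm _ 2)// (ger0_norm a2); lra.
rewrite normrM (@ger0_norm _ 2)//.
have : `|u * c + v * a - a * c| <= `|u * c| + `|v * a| + `|a * c|.
  by apply: le_trans (ler_normB _ _) _; rewrite lerD2r ler_normD.
by lra.
Qed.

(** * Weighted integral identities on H^1_0, by density *)

Section density.
Context {R : realType} {n : nat}.
Variables (Theta : set 'rV[R]_n.+1) (h h' : R -> R) (u : @sobpair R n.+1).
Hypothesis oTheta : open Theta.
Hypothesis bTheta : bounded_set Theta.
Hypothesis dh : forall x : 'rV[R]_n.+1, closure Theta x ->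
  is_derive (x1 x) (1 : R) h (h' (x1 x)).
Hypothesis ch' : forall x : 'rV[R]_n.+1, closure Theta x ->
  {for x1 x, continuous h'}.
Hypothesis Hu : H10 Theta u.
Local Notation mu := (lebesgue_rV R n.+1).

Let mTheta := open_measurable_rV oTheta.
Let muTheta := bounded_lebesgue_rV_lty mTheta bTheta.

(** Boundedness comes from compactness of the closure, measurability from continuity on the open set
    itself. *)
Lemma continuous_coef (b : 'rV[R]_n.+1 -> R) :
  (forall x, closure Theta x -> {for x, continuous b}) ->
  exists2 C : R, 0 <= C & measurable_fun Theta b /\
    forall x, Theta x -> `|b x| <= C.
Proof.
move=> cb.
have [C C0 bC] : exists2 C : R, 0 <= C & forall x, closure Theta x -> `|b x| <= C.
  apply: compact_continuous_bounded; first exact: closure_compact.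
  apply: continuous_in_subspaceT => x.
  by rewrite inE; exact: cb.
exists C => //; split; last by move=> x /subset_closure/bC.
apply: continuous_measurable_rV => // x; rewrite inE => /subset_closure.
exact: cb.
Qed.

(** This is the weak product rule for h(x_1) u. Since [chi] need not vanish near the boundary, it
    will identify the weak gradient of the extension by zero. *)
Lemma weighted_weak_gradient i chi : smooth chi ->
  \int[mu]_(x in Theta)
    (u.1 x * ((i == ord0)%:R * h' (x1 x) * chi x + h (x1 x) * partial i chi x) +
     u.2 x ord0 i * (h (x1 x) * chi x)) = 0.
Proof.
move=> schi.
pose b0 x := (i == ord0)%:R * h' (x1 x) * chi x + h (x1 x) * partial i chi x.
pose b1 x := h (x1 x) * chi x.
have [C0 C00 [mb0 b0C]] : exists2 C : R, 0 <= C & measurable_fun Theta b0 /\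
    forall x, Theta x -> `|b0 x| <= C.
  apply: continuous_coef => x cx.
  have c1 := continuous_h_x1 dh cx; have c2 := continuous_h'_x1 ch' cx.
  have c3 := @smooth_continuous _ _ _ schi x.
  have c4 := @smooth_partial_continuous _ _ _ i schi x.
  exact: (cvgD (cvgM (cvgM (cvg_cst ((i == ord0)%:R : R)) c2) c3) (cvgM c1 c4)).
have [C1 C10 [mb1 b1C]] : exists2 C : R, 0 <= C & measurable_fun Theta b1 /\
    forall x, Theta x -> `|b1 x| <= C.
  apply: continuous_coef => x cx.
  have c1 := continuous_h_x1 dh cx.
  have c3 := @smooth_continuous _ _ _ schi x.
  exact: (cvgM c1 c3).
have [[Lu LDu _] _] := Hu.
have Lb0 := L2fun_bounded mTheta muTheta mb0 b0C.
have Lb1 := L2fun_bounded mTheta muTheta mb1 b1C.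
have intf : mu.-integrable Theta
    (EFin \o (fun x => u.1 x * b0 x + u.2 x ord0 i * b1 x)).
  by apply: integrable_RD => //; exact: integrable_L2_mul.
apply: (Rintegral_approx0 mTheta (K := (C0 + C1) * (fine (mu Theta) + 1)) intf).
move=> e /andP[e0 e1].
(* The squared distance is taken below e^2 because it reappears below divided by [e]. *)
have [phi tphi [intd de]] := H10_approx oTheta bTheta Hu (exprn_gt0 2 e0).
set d := (X in EFin \o X) in intd.
exists (weighted_partial h h' phi chi i), (fun x => (C0 + C1) * (e + e^-1 * d x)).
have intg : mu.-integrable Theta (EFin \o (fun x => e + e^-1 * d x)).
  apply: integrable_RD => //; last exact: integrable_RZl.
  exact: integrable_cst.
split.
- split; first exact: integrable_weighted_partial.
  exact: integral_weighted_partial.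
- by apply: integrable_RZl.
- move=> x Tx.
  pose a := u.1 x - phi x; pose c := u.2 x ord0 i - partial i phi x.
  have -> : u.1 x * b0 x + u.2 x ord0 i * b1 x - weighted_partial h h' phi chi i x =
      a * b0 x + c * b1 x.
    by rewrite /a /c /weighted_partial /b0 /b1; ring.
  have ad : a ^+ 2 <= d x by rewrite lerDl sqnorm_ge0.
  have cd : c ^+ 2 <= d x.
    apply: le_trans (_ : sqnorm (u.2 x - grad phi x) <= _); last first.
      by rewrite lerDr sqr_ge0.
    by apply: le_trans (sqr_coord_le_sqnorm _ i); rewrite !mxE.
  (* The error is linear in the differences; this converts it into the squared distance, whose
     integral is controlled. *)
  have Y z : z ^+ 2 <= d x -> `|z| <= e + e^-1 * d x.
    move=> zd; have : 2 * e * `|z| <= e ^+ 2 + d x.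
      apply: le_trans (_ : e ^+ 2 + z ^+ 2 <= _); last by rewrite lerD2l.
      by have := sqr_ge0 (e - `|z|); rewrite -[z ^+ 2]real_normK ?num_real//; nra.
    have z0 := normr_ge0 z; move=> h1.
    rewrite -(ler_pM2l e0) mulrDr mulVKf ?gt_eqF// -expr2.
    by have := mulr_ge0 (ltW e0) z0; lra.
  apply: le_trans (ler_normD _ _) _; rewrite [leRHS]mulrDl; apply: lerD.
    by rewrite normrM mulrC ler_pM// ?Y ?b0C.
  by rewrite normrM mulrC ler_pM// ?Y ?b1C.
- rewrite RintegralZl// RintegralD//; last 2 first.
  + exact: integrable_cst.
  + exact: integrable_RZl.
  rewrite Rintegral_cst// RintegralZl// mulrCA ler_wpM2l ?addr_ge0// mulrDr lerD2l.
  by rewrite mulr1 ler_pdivrMl// -expr2.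
Qed.

(** The integrand is the x_1-derivative of h(x_1) u^2. For a test function it is [weighted_partial]
    with both factors equal to [phi], and the error is the one estimated in
    [weighted_young_bound]. *)
Lemma weighted_divergence :
  mu.-integrable Theta (EFin \o (fun x => h' (x1 x) * (u.1 x * u.1 x) +
    2 * h (x1 x) * (u.1 x * u.2 x ord0 ord0))) /\
  \int[mu]_(x in Theta) (h' (x1 x) * (u.1 x * u.1 x) +
    2 * h (x1 x) * (u.1 x * u.2 x ord0 ord0)) = 0.
Proof.
have [C0 C00 [mb0 b0C]] := continuous_coef (fun x => @continuous_h'_x1 _ _ _ h' ch' x).
have [C1 C10 [mb1 b1C]] := continuous_coef (fun x => @continuous_h_x1 _ _ _ h h' dh x).
have [[Lu LDu _] _] := Hu.
have intf : mu.-integrable Theta (EFin \o (fun x => h' (x1 x) * (u.1 x * u.1 x) +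
    2 * h (x1 x) * (u.1 x * u.2 x ord0 ord0))).
  apply: integrable_RD => //.
    apply: (integrable_bounded_mul mTheta mb0 b0C); exact: integrable_L2_mul.
  have -> : (fun x => 2 * h (x1 x) * (u.1 x * u.2 x ord0 ord0)) =
      (fun x => 2 * (h (x1 x) * (u.1 x * u.2 x ord0 ord0))).
    by apply/funext => x; rewrite -mulrA.
  apply: integrable_RZl => //.
  apply: (integrable_bounded_mul mTheta mb1 b1C); exact: integrable_L2_mul.
split => //.
pose U x := u.1 x ^+ 2 + u.2 x ord0 ord0 ^+ 2.
have intU : mu.-integrable Theta (EFin \o U).
  by apply: integrable_RD => //; [exact: Lu.2|exact: (LDu ord0).2].
apply: (Rintegral_approx0 mTheta
  (K := (C0 + C1) * (2 * \int[mu]_(x in Theta) U x + 4)) intf).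
move=> e /andP[e0 e1].
have [phi tphi [intd de]] := H10_approx oTheta bTheta Hu (exprn_gt0 2 e0).
set d := (X in EFin \o X) in intd.
have [sphi _ _] := tphi.
have i1 : mu.-integrable Theta (EFin \o (fun x => 2 * e * U x)).
  exact: integrable_RZl.
have i2 : mu.-integrable Theta (EFin \o (fun x => 4 * e^-1 * d x)).
  exact: integrable_RZl.
have i12 := integrable_RD mTheta i1 i2.
exists (weighted_partial h h' phi phi ord0),
  (fun x => (C0 + C1) * (2 * e * U x + 4 * e^-1 * d x)); split.
- split; first exact: integrable_weighted_partial.
  exact: integral_weighted_partial.
- by apply: integrable_RZl.
- move=> x Tx.
  pose a := u.1 x - phi x; pose c := u.2 x ord0 ord0 - partial ord0 phi x.
  have acd : a ^+ 2 + c ^+ 2 <= d x.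
    rewrite lerD2l; apply: le_trans (sqr_coord_le_sqnorm _ ord0).
    by rewrite !mxE.
  have -> : h' (x1 x) * (u.1 x * u.1 x) + 2 * h (x1 x) * (u.1 x * u.2 x ord0 ord0) -
      weighted_partial h h' phi phi ord0 x =
      h' (x1 x) * (2 * u.1 x * a - a ^+ 2) +
      h (x1 x) * (2 * (u.1 x * c + u.2 x ord0 ord0 * a - a * c)).
    by rewrite /a /c /weighted_partial eqxx mul1r; ring.
  apply: le_trans (ler_normD _ _) _; rewrite [leRHS]mulrDl; apply: lerD.
    rewrite normrM ler_pM// ?b0C// (weighted_young_bound (u.1 x) (u.2 x ord0 ord0) e0 e1 acd).1//.
  rewrite normrM ler_pM// ?b1C// (weighted_young_bound (u.1 x) (u.2 x ord0 ord0) e0 e1 acd).2//.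
- rewrite RintegralZl// RintegralD//.
  rewrite RintegralZl// RintegralZl// mulrCA ler_wpM2l ?addr_ge0//.
  (* Hence the total error is at most e (C0 + C1) (2 int U + 4). *)
  have : e^-1 * \int[mu]_(x in Theta) d x <= e by rewrite ler_pdivrMl// -expr2.
  by move: (\int[mu]_(x in Theta) U x) (\int[mu]_(x in Theta) d x) => A B; lra.
Qed.

End density.

(** * The one-dimensional Hardy weight *)

Section weights.
Context {R : realType}.
Variables (kap q c b : R).
Hypotheses (kap0 : 0 <= kap) (q0 : 0 < q) (q1 : q < 1) (c0 : 0 < c) (b0 : 0 < b).
(** Here [k] is a real number. In the application b = beta and c = k/(2 beta), so it is the exponent
    of the weight and [a] is k/2^*. The zero T of the supersolution lies beyond [b] because q <
    1. *)
Let k := 2 * c * b.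
Let a := q * k / 2.
Let T := (2 - q) * b.

Let T_gt (t : R) : t <= b -> 0 < T - t.
Proof.
move=> tb; have : 0 < (1 - q) * b by rewrite mulr_gt0 ?subr_gt0.
by rewrite /T; lra.
Qed.

(* [- u0' / u0] for the supersolution [u0 t = expR (- c * t) * (T - t)] *)
Definition riccati (t : R) : R := c + (T - t)^-1.

(** The function H of the overview. Its first term cancels the cross term of kap |grad w|^2; its
    second completes the square (D + riccati t * w)^2, with coefficient t^k - kap t^(2 a). *)
Definition flux (t : R) : R :=
  kap * a * (t `^ (2 * a) / t) + (t `^ k - kap * t `^ (2 * a)) * riccati t.

Definition flux' (t : R) : R :=
  kap * a * (2 * a - 1) * (t `^ (2 * a) / t ^+ 2) +
  (k * (t `^ k / t) - kap * (2 * a) * (t `^ (2 * a) / t)) * riccati t +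
  (t `^ k - kap * t `^ (2 * a)) * (T - t)^-1 ^+ 2.

(** Writing t^s / t instead of t^(s - 1) leaves t^s as a single atom for [field]. *)
Lemma is_derive_powR_div (s t : R) : 0 < t ->
  is_derive t (1 : R) (fun x => x `^ s) (s * (t `^ s / t)).
Proof.
move=> t0; apply: (is_derive_eq (is_derive1_powR s t0)).
by rewrite powRB ?powRr1// ?(ltW t0)// (gt_eqF t0) implybT.
Qed.

Lemma is_derive_powR_div2 (s t : R) : 0 < t ->
  is_derive t (1 : R) (fun x => x `^ s / x) ((s - 1) * (t `^ s / t ^+ 2)).
Proof.
move=> t0; have d3 : is_derive t (1 : R) (fun x : R => x^-1) (- t ^- 2 *: 1).
  by apply: is_deriveV; rewrite gt_eqF.
apply: is_derive_eq (is_deriveM (is_derive_powR_div s t0) d3) _.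
by rewrite /GRing.scale/=; field; rewrite gt_eqF.
Qed.

Lemma is_derive_flux t : 0 < t -> t <= b -> is_derive t (1 : R) flux (flux' t).
Proof.
move=> t0 tb.
have Tt : T - t != 0.
  by rewrite gt_eqF// T_gt.
have d1 := is_derive_powR_div (2 * a) t0.
have d2 := is_derive_powR_div k t0.
have d3 := is_derive_powR_div2 (2 * a) t0.
have d4 : is_derive t (1 : R) (fun x : R => (T - x)^-1) (- (T - t) ^- 2 *: (0 - 1)).
  by apply: is_deriveV => //; exact: is_deriveB.
have d5 : is_derive t (1 : R) riccati (0 + - (T - t) ^- 2 *: (0 - 1)).
  exact: is_deriveD.
have d6 : is_derive t (1 : R) (fun x : R => x `^ k - kap * x `^ (2 * a)) _ :=
  is_deriveB d2 (is_deriveZ kap d1).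
have d7 : is_derive t (1 : R) flux _ :=
  is_deriveD (is_deriveZ (kap * a) d3) (is_deriveM d6 d5).
apply: is_derive_eq d7 _.
rewrite /flux' /GRing.scale/=.
by move: (riccati t) (t `^ k) (t `^ (2 * a)) => g y P; field; rewrite Tt gt_eqF.
Qed.

Lemma continuous_flux' t : 0 < t -> t <= b -> {for t, continuous flux'}.
Proof.
move=> t0 tb.
have Tt : T - t != 0.
  by rewrite gt_eqF// T_gt.
have cP (s : R) : {for t, continuous (fun x : R => x `^ s)}.
  have := is_derive_powR_div s t0 => d.
  exact/differentiable_continuous/derivable1_diffP.
have cV : {for t, continuous (fun x : R => x^-1)}.
  by apply: inv_continuous; rewrite gt_eqF.
have cs : {for t, continuous (fun x : R => (T - x)^-1)}.
  by apply: (cvgV Tt); exact: (cvgB (cvg_cst T) cvg_id).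
have cg : {for t, continuous riccati}.
  exact: (cvgD (cvg_cst c) cs).
have cP2 := cP (2 * a).
have cE : {for t, continuous (fun x : R => x `^ k - kap * x `^ (2 * a))}.
  exact: (cvgB (cP k) (cvgM (cvg_cst kap) cP2)).
have cV2 : {for t, continuous (fun x : R => x ^- 2)}.
  apply: cvgV; [by rewrite expf_eq0 gt_eqF|exact: exprn_continuous].
have cs2 : {for t, continuous (fun x : R => (T - x)^-1 ^+ 2)}.
  by rewrite (_ : (fun x : R => _) = (fun x => (T - x)^-1 * (T - x)^-1));
    [exact: (cvgM cs cs)|apply/funext => x; rewrite expr2].
have c1 : {for t, continuous (fun x : R => kap * a * (2 * a - 1) * (x `^ (2 * a) / x ^+ 2))}.
  exact: (cvgM (cvg_cst (kap * a * (2 * a - 1))) (cvgM cP2 cV2)).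
have c2 : {for t, continuous (fun x : R => k * (x `^ k / x) - kap * (2 * a) * (x `^ (2 * a) / x))}.
  exact: (cvgB (cvgM (cvg_cst k) (cvgM (cP k) cV))
              (cvgM (cvg_cst (kap * (2 * a))) (cvgM cP2 cV))).
exact: (cvgD (cvgD c1 (cvgM c2 cg)) (cvgM cE cs2)).
Qed.

(** After multiplication by t^2 the expression is (y - z) E0 + z E1, where E0 and E1 are its values
    at the endpoints z/y = 0 and z/y = 1, normalised by y = 1. *)
Lemma flux_bracket_ge0 (lam t y z : R) : lam <= c ^+ 2 -> q * b <= t -> t <= b ->
  0 <= z -> z <= y ->
  0 <= - lam * y + z * a * (a - 1) / t ^+ 2 + (k * y - 2 * a * z) * riccati t / t +
    (y - z) * ((T - t)^-1 ^+ 2 - riccati t ^+ 2).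
Proof.
move=> lc qt tb z0 zy.
have t0 : 0 < t by apply: lt_le_trans qt; exact: mulr_gt0.
have Tt := T_gt tb.
pose s := (T - t)^-1; have s0 : 0 < s by rewrite invr_gt0.
have sE : s * (T - t) = 1 by rewrite mulVf ?gt_eqF.
rewrite /riccati -/s.
have lt2 : lam * t ^+ 2 <= c ^+ 2 * t ^+ 2 by rewrite ler_wpM2r ?sqr_ge0.
(* Endpoint z = 0: only t <= b and lam <= c^2 enter. *)
have E0 : 0 <= k * t * (c + s) + t ^+ 2 * (s ^+ 2 - (c + s) ^+ 2) - lam * t ^+ 2.
  have -> : k * t * (c + s) + t ^+ 2 * (s ^+ 2 - (c + s) ^+ 2) - lam * t ^+ 2 =
     2 * c ^+ 2 * t * (b - t) + 2 * c * t * s * (b - t) +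
     (c ^+ 2 * t ^+ 2 - lam * t ^+ 2) by rewrite /k; ring.
  by rewrite addr_ge0 ?subr_ge0// addr_ge0// mulr_ge0 ?subr_ge0// !mulr_ge0// ?sqr_ge0// ltW.
(* Endpoint z = y: the negative part -a of a (a - 1) must be compensated, which requires the lower
   bound q b <= t. *)
have E1 : 0 <= k * t * (1 - q) * (c + s) + a * (a - 1) - lam * t ^+ 2.
  (* From t >= q b one gets T - t <= 2 (1 - q) b, so q (T - t) <= 2 (1 - q) t. Equality holds at t =
     q b, which explains the value (2 - q) b of T. *)
  have ts : q <= 2 * t * (1 - q) * s.
    rewrite -ler_pdivrMr// invrK; apply: le_trans (_ : q * (2 * (1 - q) * b) <= _).
      by rewrite ler_pM2l// /T; lra.
    have : (1 - q) * (q * b) <= (1 - q) * t by rewrite ler_pM2l ?subr_gt0.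
    by lra.
  have -> : k * t * (1 - q) * (c + s) + a * (a - 1) - lam * t ^+ 2 =
     c ^+ 2 * (2 * t * (b - t) + (t - q * b) ^+ 2) +
     c * b * (2 * t * (1 - q) * s - q) + (c ^+ 2 * t ^+ 2 - lam * t ^+ 2).
    by rewrite /a /k; field.
  rewrite addr_ge0 ?subr_ge0// addr_ge0// mulr_ge0 ?subr_ge0 ?sqr_ge0//.
    by rewrite addr_ge0 ?sqr_ge0// !mulr_ge0// ?subr_ge0// ltW.
  by rewrite mulr_ge0// ltW.
rewrite -(pmulr_lge0 _ (exprn_gt0 2 t0)).
have -> : (- lam * y + z * a * (a - 1) / t ^+ 2 + (k * y - 2 * a * z) * (c + s) / t +
    (y - z) * (s ^+ 2 - (c + s) ^+ 2)) * t ^+ 2 =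
  (y - z) * (k * t * (c + s) + t ^+ 2 * (s ^+ 2 - (c + s) ^+ 2) - lam * t ^+ 2) +
  z * (k * t * (1 - q) * (c + s) + a * (a - 1) - lam * t ^+ 2).
  by rewrite /a /k; field; rewrite gt_eqF.
by rewrite addr_ge0// mulr_ge0// subr_ge0.
Qed.

(* With y = t^k and z = kap t^(2 a), the difference of the two sides is
   (y - z) (S - D^2) + (y - z) (D + riccati t * w)^2 plus w^2 times the bracket
   of [flux_bracket_ge0]. *)
Lemma flux_pointwise (lam t w D S : R) : lam <= c ^+ 2 -> q * b <= t -> t <= b ->
  kap * t `^ (2 * a) <= t `^ k -> D ^+ 2 <= S ->
  kap * t `^ (2 * a) * (S + 2 * a / t * (w * D) + (a / t) ^+ 2 * w ^+ 2) <=
  t `^ k * S - lam * (t `^ k * w ^+ 2) +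
    (flux' t * (w * w) + 2 * flux t * (w * D)).
Proof.
move=> lc qt tb zy DS.
have t0 : 0 < t by apply: lt_le_trans qt; exact: mulr_gt0.
rewrite /flux /flux'.
have z0 : 0 <= kap * t `^ (2 * a) by rewrite mulr_ge0// powR_ge0.
have B := flux_bracket_ge0 lc qt tb z0 zy.
move: z0 zy B; set P := t `^ (2 * a); set y := t `^ k => z0 zy.
set B := (X in 0 <= X) => B0.
rewrite -subr_ge0.
have -> : y * S - lam * (y * w ^+ 2) +
  ((kap * a * (2 * a - 1) * (P / t ^+ 2) +
   (k * (y / t) - kap * (2 * a) * (P / t)) * riccati t +
   (y - kap * P) * (T - t)^-1 ^+ 2) * (w * w) +
   2 * (kap * a * (P / t) + (y - kap * P) * riccati t) * (w * D)) -
  kap * P * (S + 2 * a / t * (w * D) + (a / t) ^+ 2 * w ^+ 2) =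
  (y - kap * P) * (S - D ^+ 2) + (y - kap * P) * (D + riccati t * w) ^+ 2 + w ^+ 2 * B.
  rewrite /B; move: (riccati t) (T - t)^-1 => g s; field; rewrite gt_eqF//.
by apply: addr_ge0; [apply: addr_ge0|]; rewrite mulr_ge0 ?subr_ge0 ?sqr_ge0.
Qed.

End weights.

(** * The Sobolev constant as a supremum *)

Section sobolev_constant.
Context {R : realType} {n : nat}.

Lemma sobolev_inequality0 : @sobolev_inequality R n 0.
Proof.
move=> u _; rewrite mul0e; apply: integral_ge0 => x _.
by rewrite lee_fin sqnorm_ge0.
Qed.

(* The supremum of an unbounded set is 0, so this needs no Sobolev embedding. *)
Lemma sobolev_const_ge0 : 0 <= sobolev_const R n.
Proof.
have [hs|/sup_out h] := pselect (has_sup [set s | @sobolev_inequality R n s]);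
  last by have -> : sobolev_const R n = 0 by exact: h.
exact: (ub_le_sup hs.2 sobolev_inequality0).
Qed.

(** A nonzero supremum is a genuine one, and the inequality, being closed in the constant, passes to
    it; the infinite cases are treated apart. *)
Lemma sobolev_constP : 0 < sobolev_const R n ->
  sobolev_inequality n (sobolev_const R n).
Proof.
move=> S0 u Hu.
have hs : has_sup [set s | @sobolev_inequality R n s].
  apply: contrapT => /sup_out h.
  by have h' : sobolev_const R n = 0; [exact: h|move: S0; rewrite h' ltxx].
set X := ((\int[_]_x _) `^ _)%E; set Y := (\int[_]_x (sqnorm _)%:E)%E.
have X0 : (0 <= X)%E by exact: poweR_ge0.
have XY s : sobolev_inequality n s -> (s%:E * X <= Y)%E.
  by move=> /(_ u Hu).
have Y0 : (0 <= Y)%E by apply: integral_ge0 => x _; rewrite lee_fin sqnorm_ge0.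
(* With tolerance equal to the supremum itself this yields an admissible constant s > 0, which rules
   out an infinite left-hand norm with a finite right-hand side. *)
have [s hsS sS] := sup_adherent S0 hs.
move: X Y X0 XY Y0 => [x| |] [y| |]//.
- rewrite !lee_fin => x0 XY y0; rewrite leNgt; apply/negP => yS.
  have xpos : 0 < x.
    by rewrite lt_neqAle x0 andbT; apply: contraTneq yS => <-; rewrite mulr0 -leNgt.
  (* If the inequality failed, y/x would lie below the supremum, and an admissible constant above
     y/x would contradict it. *)
  have : 0 < sobolev_const R n - y / x by rewrite subr_gt0 ltr_pdivrMr.
  move=> /sup_adherent/(_ hs)[s' hs' ]; rewrite subKr ltr_pdivrMr// ltNge.
  by rewrite -lee_fin EFinM XY.
- by move=> *; rewrite leey.
- move=> _ XY _; have := XY _ hsS; rewrite gt0_muley// lte_fin.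
  by move: sS; rewrite subrr.
- by move=> *; rewrite leey.
Qed.

End sobolev_constant.

(** If the integral is infinite, both sides are 0, because the real-valued integral sends +oo to
    0. *)
Lemma ge0_RintegralZl d (T : measurableType d) (R : realType)
    (mu : {measure set T -> \bar R}) (D : set T) (f : T -> R) (c : R) :
  measurable D -> measurable_fun D f -> (forall x, D x -> 0 <= f x) -> 0 <= c ->
  \int[mu]_(x in D) (c * f x) = c * \int[mu]_(x in D) f x.
Proof.
move=> mD mf f0 c0; rewrite /Rintegral.
under eq_integral do rewrite EFinM.
rewrite ge0_integralZl_EFin//; last exact/measurable_EFinP.
have [->|cn0] := eqVneq c 0; first by rewrite mul0e mul0r.
have : 0 < c by rewrite lt_neqAle eq_sym cn0.
case: (\int[mu]_(x in D) (f x)%:E)%E => [r| |] c1 //=.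
- by rewrite gt0_muley ?lte_fin//= mulr0.
- by rewrite gt0_muleNy ?lte_fin//= mulr0.
Qed.

Lemma sqnormZ {R : realType} {n} (c : R) (v : 'rV[R]_n) :
  sqnorm (c *: v) = c ^+ 2 * sqnorm v.
Proof.
rewrite /sqnorm /dotv mulr_sumr; apply: eq_bigr => i _; rewrite !mxE; ring.
Qed.

(** * The energy along a ray and the Nehari constraint *)

Section nehari.
Context {R : realType} {n : nat}.
Variables (Theta : set 'rV[R]_n.+1) (k : nat) (u : @sobpair R n.+1).
Hypothesis mTheta : measurable Theta.
Hypothesis x1_ge0 : forall x : 'rV[R]_n.+1, Theta x -> 0 <= x1 x.
Hypothesis mu1 : measurable_fun Theta u.1.
Hypothesis mu2 : forall i, measurable_fun Theta (fun x => u.2 x ord0 i).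
Local Notation mu := (lebesgue_rV R n.+1).
Local Notation p := (crit_exp R n.+1).

Let A := \int[mu]_(x in Theta) (x1 x ^+ k * sqnorm (u.2 x)).
Let B := \int[mu]_(x in Theta) (x1 x ^+ k * u.1 x ^+ 2).
Let C := \int[mu]_(x in Theta) (x1 x ^+ k * `|u.1 x| `^ p).

Let mx1k : measurable_fun Theta (fun x : 'rV[R]_n.+1 => x1 x ^+ k).
Proof.
apply: measurable_funX; apply: measurable_funTS; exact: measurable_coord.
Qed.

Lemma measurable_sqnorm : measurable_fun Theta (fun x => sqnorm (u.2 x)).
Proof.
rewrite /sqnorm /dotv.
apply: (@measurable_sum _ _ _ _ _ _ (fun i x => u.2 x ord0 i * u.2 x ord0 i)) => i.
exact: measurable_funM.
Qed.

Lemma measurable_powR_norm : measurable_fun Theta (fun x => `|u.1 x| `^ p).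
Proof.
apply: (measurableT_comp (@measurable_powR R _)).
exact: measurableT_comp.
Qed.

Lemma energy_scale (lam t : R) : energy Theta k lam (u + t *: u) =
  (1 + t) ^+ 2 * (1 / 2 * A - lam / 2 * B) - `|1 + t| `^ p * (1 / p * C).
Proof.
rewrite /energy.
have -> : \int[mu]_(x in Theta) (x1 x ^+ k * sqnorm ((u + t *: u).2 x)) =
    (1 + t) ^+ 2 * A.
  rewrite -ge0_RintegralZl ?sqr_ge0//; last 2 first.
  - by apply: measurable_funM => //; exact: measurable_sqnorm.
  - by move=> x Tx; apply: mulr_ge0; [exact/exprn_ge0/x1_ge0|exact: sqnorm_ge0].
  apply: eq_Rintegral => x _.
  have -> : (u + t *: u).2 x = (1 + t) *: u.2 x by rewrite scalerDl scale1r.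
  by rewrite sqnormZ; ring.
have -> : \int[mu]_(x in Theta) (x1 x ^+ k * (u + t *: u).1 x ^+ 2) =
    (1 + t) ^+ 2 * B.
  rewrite -ge0_RintegralZl ?sqr_ge0//; last 2 first.
  - by apply: measurable_funM => //; exact: measurable_funX.
  - by move=> x Tx; apply: mulr_ge0; [exact/exprn_ge0/x1_ge0|exact: sqr_ge0].
  apply: eq_Rintegral => x _.
  have -> : (u + t *: u).1 x = (1 + t) * u.1 x by rewrite mulrDl mul1r.
  ring.
have -> : \int[mu]_(x in Theta) (x1 x ^+ k * `|(u + t *: u).1 x| `^ p) =
    `|1 + t| `^ p * C.
  rewrite -ge0_RintegralZl ?powR_ge0//; last 2 first.
  - by apply: measurable_funM => //; exact: measurable_powR_norm.
  - by move=> x Tx; apply: mulr_ge0; [exact/exprn_ge0/x1_ge0|exact: powR_ge0].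
  apply: eq_Rintegral => x _.
  have -> : (u + t *: u).1 x = (1 + t) * u.1 x by rewrite mulrDl mul1r.
  by rewrite normrM powRM// mulrCA.
ring.
Qed.

(** By [energy_scale] the energy along the ray is an explicit function of [t], to be differentiated
    at 0. *)
Lemma denergy_self (lam : R) : p != 0 -> denergy Theta k lam u u = A - lam * B - C.
Proof.
move=> p0; rewrite /denergy derive1E.
set P0 := 1 / 2 * A - lam / 2 * B.
rewrite (@near_eq_derive _ _ _ _
  (fun t : R => (1 + t) * (1 + t) * P0 - (1 + t) `^ p * (1 / p * C))); last first.
  (* For |t| < 1 the number 1 + t is positive and the absolute value disappears. *)
  near=> t; rewrite energy_scale -expr2 ger0_norm//.
  have : `|t| < 1.
    near: t; exists 1 => //= t; rewrite /ball_ /= sub0r normrN; exact.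
  by rewrite ltr_norml => /andP[t1 _]; rewrite -lerBlDl sub0r ltW.
have d1 : is_derive (0 : R) (1 : R) (fun t : R => 1 + t) (0 + 1).
  exact: is_deriveD.
have d2 : is_derive (0 : R) (1 : R) (fun t : R => (1 + t) `^ p) (p * (0 + 1)).
  have := @is_derive1_comp R (fun t => t `^ p) (fun t : R => 1 + t) 0 p (0 + 1).
  apply => //; rewrite addr0; apply: is_derive_eq (is_derive1_powR p ltr01) _.
  by rewrite powR1 mulr1.
have d3 : is_derive (0 : R) (1 : R) (fun t : R => (1 + t) * (1 + t)) _ := is_deriveM d1 d1.
have d4 : is_derive (0 : R) (1 : R)
  (fun t : R => (1 + t) * (1 + t) * P0 - (1 + t) `^ p * (1 / p * C)) _ :=
  is_deriveB (is_deriveM d3 (is_derive_cst P0 (0 : R) (1 : R)))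
             (is_deriveM d2 (is_derive_cst (1 / p * C) (0 : R) (1 : R))).
rewrite (@derive_val _ _ _ _ _ _ _ d4) /P0 /GRing.scale/= !addr0 add0r.
field.
Unshelve. all: by end_near. Qed.

End nehari.

(** * The function w = x_1^a u, extended by zero *)

Section power_extension.
Context {R : realType} {n : nat}.
Variables (Theta : set 'rV[R]_n.+1) (a : R) (u : @sobpair R n.+1).
Hypothesis oTheta : open Theta.
Hypothesis bTheta : bounded_set Theta.
Hypothesis x1_gt0 : forall x : 'rV[R]_n.+1, closure Theta x -> 0 < x1 x.
Hypothesis Hu : H10 Theta u.
Local Notation mu := (lebesgue_rV R n.+1).

Let mTheta := open_measurable_rV oTheta.

Definition power_ext_grad (x : 'rV[R]_n.+1) : 'rV[R]_n.+1 :=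
  \row_i (x1 x `^ a * u.2 x ord0 i +
          (i == ord0)%:R * (a * (x1 x `^ a / x1 x)) * u.1 x).

Definition power_ext : @sobpair R n.+1 :=
  ((fun x => x1 x `^ a * u.1 x) \_ Theta,
   fun x => if x \in Theta then power_ext_grad x else 0).

Let dh (x : 'rV[R]_n.+1) : closure Theta x ->
  is_derive (x1 x) (1 : R) (fun t => t `^ a) (a * (x1 x `^ a / x1 x)).
Proof. by move=> /x1_gt0; exact: is_derive_powR_div. Qed.

Let ch' (x : 'rV[R]_n.+1) : closure Theta x ->
  {for x1 x, continuous (fun t : R => a * (t `^ a / t))}.
Proof.
move=> /x1_gt0 t0.
have d := is_derive_powR_div2 a t0.
have c : {for x1 x, continuous (fun t : R => t `^ a / t)}.
  exact/differentiable_continuous/derivable1_diffP.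
exact: (cvgM (cvg_cst a) c).
Qed.

Lemma L2fun_power_ext1 : L2fun Theta (fun x => x1 x `^ a * u.1 x).
Proof.
have [C _ [mb bC]] := continuous_coef oTheta bTheta
  (fun x => @continuous_h_x1 _ _ _ _ (fun t => a * (t `^ a / t)) dh x).
apply: (@L2fun_bounded_mul _ _ _ mTheta _ _ C) => //.
by have [[]] := Hu.
Qed.

Lemma L2fun_power_ext2 i : L2fun Theta (fun x => power_ext_grad x ord0 i).
Proof.
have [C1 _ [mb1 b1C]] := continuous_coef oTheta bTheta
  (fun x => @continuous_h_x1 _ _ _ _ (fun t => a * (t `^ a / t)) dh x).
have [C2 _ [mb2 b2C]] := continuous_coef oTheta bTheta
  (fun x => @continuous_h'_x1 _ _ _ (fun t => a * (t `^ a / t)) ch' x).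
have [[Lu LDu _] _] := Hu.
rewrite /power_ext_grad; under eq_fun do rewrite mxE.
apply: L2funD => //; first exact: (@L2fun_bounded_mul _ _ _ mTheta _ _ C1).
apply: (@L2fun_bounded_mul _ _ _ mTheta _ _ C2) => //.
  by apply: measurable_funM => //; exact: measurable_cst.
move=> x /b2C; apply: le_trans; rewrite normrM.
by case: (i == ord0) => /=; rewrite ?normr1 ?mul1r// normr0 mul0r.
Qed.

Lemma L2fun_patch (f : 'rV[R]_n.+1 -> R) :
  L2fun Theta f -> L2fun setT (f \_ Theta).
Proof.
move=> [mf f2]; split; first exact/(measurable_restrictT _ mTheta).
have := (integrable_mkcond (fun x => (f x ^+ 2)%:E) mTheta).1 f2.
apply: eq_integrable => // x _; rewrite !patchE; case: ifPn => // _.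
by rewrite expr0n.
Qed.

(** Testing on the whole space reduces to integrals over [Theta], where [weighted_weak_gradient]
    holds for test functions that do not vanish at the boundary. *)
Lemma H1_power_ext : H1 setT power_ext.
Proof.
have [[Lu LDu _] _] := Hu.
have E2 i : (fun x => power_ext.2 x ord0 i) =
    (fun x => power_ext_grad x ord0 i) \_ Theta.
  by apply/funext => x; rewrite patchE /power_ext /=; case: ifP => //; rewrite mxE.
split.
- exact/L2fun_patch/L2fun_power_ext1.
- by move=> i; rewrite E2; exact/L2fun_patch/L2fun_power_ext2.
move=> phi [sphi _ _] i.
have Lphi : L2fun Theta phi.
  by apply: L2fun_continuous => //; exact: smooth_continuous.
have Lphi' : L2fun Theta (partial i phi).
  by apply: L2fun_continuous => //; exact: smooth_partial_continuous.
have -> : \int[mu]_x (power_ext.1 x * partial i phi x) =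
    \int[mu]_(x in Theta) (x1 x `^ a * u.1 x * partial i phi x).
  rewrite [RHS]Rintegral_mkcond; apply: eq_Rintegral => x _.
  by rewrite /power_ext/= !patchE; case: ifP => // _; rewrite mul0r.
have -> : \int[mu]_x (power_ext.2 x ord0 i * phi x) =
    \int[mu]_(x in Theta) (power_ext_grad x ord0 i * phi x).
  rewrite [RHS]Rintegral_mkcond; apply: eq_Rintegral => x _.
  rewrite -[power_ext.2 x ord0 i]/((fun x => power_ext.2 x ord0 i) x) E2.
  by rewrite !patchE; case: ifP => // _; rewrite mul0r.
apply/eqP; rewrite -addr_eq0 -RintegralD//; last 2 first.
- by apply: integrable_L2_mul => //; exact: L2fun_power_ext1.
- by apply: integrable_L2_mul => //; exact: L2fun_power_ext2.
apply/eqP; rewrite -[RHS](weighted_weak_gradient oTheta bTheta dh ch' Hu i sphi).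
by apply: eq_Rintegral => x _; rewrite /power_ext_grad mxE; ring.
Qed.

(** A nonzero exponent makes 0^p equal to 0, so the extension contributes nothing outside
    [Theta]. *)
Lemma power_ext_norm (p : R) : p != 0 ->
  (\int[mu]_x (`|power_ext.1 x| `^ p)%:E =
   \int[mu]_(x in Theta) (x1 x `^ (a * p) * `|u.1 x| `^ p)%:E)%E.
Proof.
move=> p0; rewrite [RHS]integral_mkcond; apply: eq_integral => x _.
rewrite /power_ext/= !patchE; case: ifPn => // [xT|_]; last by rewrite normr0 powR0.
by rewrite normrM ger0_norm ?powR_ge0// powRM ?powR_ge0// powRrM.
Qed.

Lemma power_ext_grad_norm :
  (\int[mu]_x (sqnorm (power_ext.2 x))%:E =
   \int[mu]_(x in Theta) (sqnorm (power_ext_grad x))%:E)%E.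
Proof.
rewrite [RHS]integral_mkcond; apply: eq_integral => x _.
rewrite /power_ext/= !patchE; case: ifPn => // _.
by rewrite /sqnorm /dotv big1// => i _; rewrite mxE mul0r.
Qed.

(** The expansion in which |grad w|^2 enters the left-hand side of [flux_pointwise]. *)
Lemma sqnorm_power_ext_grad x : 0 < x1 x ->
  sqnorm (power_ext_grad x) = x1 x `^ (2 * a) *
    (sqnorm (u.2 x) + 2 * a / x1 x * (u.1 x * u.2 x ord0 ord0) +
     (a / x1 x) ^+ 2 * u.1 x ^+ 2).
Proof.
move=> t0; rewrite /sqnorm /dotv !big_ord_recl/= !mxE eqxx mul1r.
have -> : x1 x `^ (2 * a) = x1 x `^ a * x1 x `^ a.
  by rewrite mulr_natl mulr2n powRD // (gt_eqF t0) implybT.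
rewrite (eq_bigr (fun i => x1 x `^ a * x1 x `^ a *
    (u.2 x ord0 (lift ord0 i) * u.2 x ord0 (lift ord0 i)))); last first.
  by move=> i _; rewrite !mxE/= !mul0r !addr0; ring.
by rewrite -mulr_sumr; field; rewrite gt_eqF.
Qed.

End power_extension.

(** * Extrema of x_1 on the closure of the domain *)

Section geometry.
Context {R : realType} {n : nat}.
Variable Theta : set 'rV[R]_n.+1.
Hypothesis Theta0 : Theta !=set0.
Hypothesis bTheta : bounded_set Theta.
Hypothesis hpos : forall x : 'rV[R]_n.+1, closure Theta x -> 0 < x1 x.

Let closure0 : closure Theta !=set0.
Proof. by have [x Tx] := Theta0; exists x; exact: subset_closure. Qed.

Let x1_within : {within closure Theta, continuous (@x1 R n)}.
Proof. exact/continuous_subspaceT/x1_continuous. Qed.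

Lemma le_x1_max x : closure Theta x -> x1 x <= x1_max Theta.
Proof.
move=> cx; have [C _ xC] :=
  compact_continuous_bounded (closure_compact bTheta) x1_within.
apply: ub_le_sup; last by exists x.
by exists C => _ [y cy <-]; apply: le_trans (xC _ cy); exact: ler_norm.
Qed.

Lemma x1_min_le x : closure Theta x -> x1_min Theta <= x1 x.
Proof.
move=> cx; apply: ge_inf; last by exists x.
by exists 0 => _ [y cy <-]; exact/ltW/hpos.
Qed.

Lemma x1_min_gt0 : 0 < x1_min Theta.
Proof.
have [c] := compact_EVT_min closure0 (closure_compact bTheta) x1_within.
rewrite inE => cc cmin; apply: lt_le_trans (hpos cc) _.
apply: lb_le_inf; first by have [x cx] := closure0; exists (x1 x), x.
by move=> _ [y cy <-]; apply: cmin; rewrite inE.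
Qed.

Lemma x1_max_gt0 : 0 < x1_max Theta.
Proof.
have [x cx] := closure0.
exact: lt_le_trans (hpos cx) (le_x1_max cx).
Qed.

Lemma inf_x1X_ge0 k : 0 <= inf [set x1 x ^+ k | x in closure Theta].
Proof.
apply: lb_le_inf; first by have [x cx] := closure0; exists (x1 x ^+ k), x.
by move=> _ [y cy <-]; rewrite exprn_ge0// ltW// hpos.
Qed.

Lemma inf_x1X_le k x : closure Theta x ->
  inf [set x1 x ^+ k | x in closure Theta] <= x1 x ^+ k.
Proof.
move=> cx; apply: ge_inf; last by exists x.
by exists 0 => _ [y cy <-]; rewrite exprn_ge0// ltW// hpos.
Qed.

End geometry.

(** * The Hardy inequality and the energy bound on the Nehari manifold *)

Section ground_state.
Context {R : realType} {n : nat}.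
Hypothesis hn : (3 <= n.+1)%N.
Variable Theta : set 'rV[R]_n.+1.
Hypothesis oTheta : open Theta.
Hypothesis Theta0 : Theta !=set0.
Hypothesis bTheta : bounded_set Theta.
Hypothesis hpos : forall x : 'rV[R]_n.+1, closure Theta x -> 0 < x1 x.
Hypothesis hratio : x1_max Theta / x1_min Theta <= n.+1%:R / (n.+1%:R - 2).
Variable k : nat.
Hypothesis k1 : (1 <= k)%N.
Local Notation mu := (lebesgue_rV R n.+1).
Local Notation p := (crit_exp R n.+1).
Local Notation N := (n.+1%:R : R).
Local Notation beta := (x1_max Theta).

(** These are the parameters of the one-dimensional weight: c^2 = k^2/(4 beta^2) is the threshold
    for [lam], and a = k/2^*. *)
Let q := (N - 2) / N.
Let c := k%:R / (2 * beta).
Let a := q * k%:R / 2.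
Let K := inf [set x1 x ^+ k | x in closure Theta].
Let kap := K `^ (2 / N).

Let mTheta := open_measurable_rV oTheta.

Let N3 : 3 <= N.
Proof. by rewrite (ler_nat _ 3). Qed.

Let beta0 : 0 < beta := x1_max_gt0 Theta0 bTheta hpos.

Let q0 : 0 < q.
Proof. by have := N3; rewrite /q => h; apply: divr_gt0; lra. Qed.

Let q1 : q < 1.
Proof. by have := N3; rewrite /q => h; rewrite ltr_pdivrMr; lra. Qed.

Let c0 : 0 < c.
Proof. by rewrite divr_gt0 ?ltr0n// mulr_gt0. Qed.

Let kE : 2 * c * beta = k%:R.
Proof. by rewrite /c; field; rewrite gt_eqF. Qed.

(** The ratio hypothesis says exactly that q beta is at most the minimum of x_1. *)
Let q_beta x : closure Theta x -> q * beta <= x1 x.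
Proof.
move=> cx; apply: le_trans (x1_min_le hpos cx).
have m0 := x1_min_gt0 Theta0 bTheta hpos.
have N2 : 0 < N - 2 by have := N3; lra.
have N0 : 0 < N by have := N3; lra.
move: hratio; rewrite ler_pdivrMr// mulrAC ler_pdivlMr// => h.
by rewrite /q mulrAC ler_pdivrMr// mulrC [leRHS]mulrC.
Qed.

Let kap0 : 0 <= kap.
Proof. exact: powR_ge0. Qed.

(** Raise K <= x_1^k to the power 2/N and use 2k/N + 2a = k. *)
Let kap_le x : closure Theta x -> kap * x1 x `^ (2 * a) <= x1 x `^ k%:R.
Proof.
move=> cx; have t0 := hpos cx.
have N0 : 0 < N by have := N3; lra.
have -> : x1 x `^ k%:R = (x1 x `^ k%:R) `^ (2 / N) * x1 x `^ (2 * a).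
  rewrite -powRrM -powRD; last by rewrite (gt_eqF t0) implybT.
  by congr (_ `^ _); rewrite /a /q; field; rewrite gt_eqF.
rewrite ler_wpM2r ?powR_ge0//.
apply: ge0_ler_powR; rewrite ?nnegrE.
- by rewrite divr_ge0// ltW.
- exact: inf_x1X_ge0.
- exact: powR_ge0.
by rewrite powR_mulrn; [exact: inf_x1X_le|exact: ltW].
Qed.

Let p_neq0 : p != 0.
Proof.
rewrite /crit_exp mulf_neq0 ?mulf_neq0 ?invr_eq0 ?pnatr_eq0// gt_eqF//.
by have := N3; lra.
Qed.

Variables (lam : R) (u : @sobpair R n.+1).
Hypothesis lam_le : lam <= c ^+ 2.
Hypothesis Hu : H10 Theta u.

Let A := \int[mu]_(x in Theta) (x1 x ^+ k * sqnorm (u.2 x)).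
Let B := \int[mu]_(x in Theta) (x1 x ^+ k * u.1 x ^+ 2).
Let C := \int[mu]_(x in Theta) (x1 x ^+ k * `|u.1 x| `^ p).
Let G := \int[mu]_(x in Theta) (sqnorm (power_ext_grad a u x)).

Let integrable_G : mu.-integrable Theta (EFin \o (fun x => sqnorm (power_ext_grad a u x))).
Proof.
by apply: integrable_sqnorm => // i; exact: L2fun_power_ext2.
Qed.

(** Integration of [flux_pointwise]; the terms with the flux form an x_1-derivative and drop out by
    [weighted_divergence]. *)
Lemma weighted_hardy : kap * G <= A - lam * B.
Proof.
have [[Lu LDu _] _] := Hu.
have x1kc x : closure Theta x -> {for x, continuous (fun x : 'rV[R]_n.+1 => x1 x ^+ k)}.
  move=> _; apply: (@continuous_comp _ _ _ (@x1 R n) (fun t => t ^+ k)).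
    exact: x1_continuous.
  exact: exprn_continuous.
have [M _ [mb bM]] := continuous_coef oTheta bTheta x1kc.
have intA : mu.-integrable Theta (EFin \o (fun x => x1 x ^+ k * sqnorm (u.2 x))).
  by apply: (integrable_bounded_mul mTheta mb bM); exact: integrable_sqnorm.
have intB : mu.-integrable Theta (EFin \o (fun x => x1 x ^+ k * u.1 x ^+ 2)).
  by apply: (integrable_bounded_mul mTheta mb bM); exact: Lu.2.
have dfl x : closure Theta x ->
    is_derive (x1 x) (1 : R) (flux kap q c beta) (flux' kap q c beta (x1 x)).
  move=> cx; apply: is_derive_flux => //; [exact: hpos|exact: le_x1_max].
have cfl x : closure Theta x -> {for x1 x, continuous (flux' kap q c beta)}.
  move=> cx; apply: continuous_flux' => //; [exact: hpos|exact: le_x1_max].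
have [intF F0] := weighted_divergence oTheta bTheta dfl cfl Hu.
rewrite /A /B -RintegralZl// -RintegralB//; last exact: integrable_RZl.
rewrite -[leRHS]addr0 -F0 -RintegralD//; last first.
  by apply: integrable_RB => //; exact: integrable_RZl.
rewrite -RintegralZl//; apply: le_Rintegral => //.
- exact: integrable_RZl.
- by apply: integrable_RD => //; apply: integrable_RB => //; exact: integrable_RZl.
move=> x Tx; have cx := subset_closure Tx.
have aE' : q * (2 * c * beta) / 2 = a by rewrite kE.
have := @flux_pointwise R kap q c beta kap0 q0 q1 c0 beta0 lam (x1 x) (u.1 x)
  (u.2 x ord0 ord0) (sqnorm (u.2 x)) lam_le (q_beta cx) (le_x1_max bTheta cx).
rewrite aE' kE => /(_ (kap_le cx) (sqr_coord_le_sqnorm _ _)).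
rewrite powR_mulrn; last exact/ltW/hpos.
move=> h; apply: le_trans h.
by rewrite sqnorm_power_ext_grad ?hpos// mulrA.
Qed.

Let apE : a * p = k%:R.
Proof.
have h := N3; rewrite /a /q /crit_exp; field.
by apply/andP; split; rewrite gt_eqF//; lra.
Qed.

Let ge0_Cfun x : Theta x -> 0 <= x1 x ^+ k * `|u.1 x| `^ p.
Proof.
move=> /subset_closure/hpos t0.
by rewrite mulr_ge0 ?powR_ge0// exprn_ge0// ltW.
Qed.

Let measurable_Cfun : measurable_fun Theta (fun x => x1 x ^+ k * `|u.1 x| `^ p).
Proof.
have [[[mu1 _] _ _] _] := Hu.
apply: measurable_funM; last exact: measurable_powR_norm.
by apply: measurable_funX; apply: measurable_funTS; exact: measurable_coord.
Qed.

(** The Sobolev inequality for w, whose critical integral is that of x_1^k |u|^p because a p = k. An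
    infinite value would contradict the finiteness of [G]. *)
Lemma sobolev_weighted : 0 < sobolev_const R n.+1 ->
  (\int[mu]_(x in Theta) (x1 x ^+ k * `|u.1 x| `^ p)%:E < +oo)%E /\
  sobolev_const R n.+1 * C `^ (2 / p) <= G.
Proof.
move=> S0.
have := sobolev_constP S0 (H1_power_ext a oTheta bTheta hpos Hu).
rewrite power_ext_norm// power_ext_grad_norm apE.
have -> : (\int[mu]_(x in Theta) (x1 x `^ k%:R * `|u.1 x| `^ p)%:E =
    \int[mu]_(x in Theta) (x1 x ^+ k * `|u.1 x| `^ p)%:E)%E.
  apply: eq_integral => x; rewrite inE => /subset_closure/hpos t0.
  by rewrite powR_mulrn// ltW.
have GE : (\int[mu]_(x in Theta) (sqnorm (power_ext_grad a u x))%:E = G%:E)%E.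
  by rewrite /G fineK//; exact: integrable_fin_num.
rewrite GE /C /Rintegral.
have p20 : 0 < 2 / p.
  by have h := N3; rewrite /crit_exp; apply: divr_gt0 => //; apply: divr_gt0; lra.
have : (0 <= \int[mu]_(x in Theta) (x1 x ^+ k * `|u.1 x| `^ p)%:E)%E.
  by apply: integral_ge0 => x Tx; rewrite lee_fin ge0_Cfun.
case: (\int[mu]_(x in Theta) (x1 x ^+ k * `|u.1 x| `^ p)%:E)%E => [r| |]// r0.
  by rewrite /= ltry lee_fin.
by rewrite poweRyr ?gt_eqF// gt0_muley.
Qed.

(** Since an infinite integral also has real value 0, finiteness comes first; then C = 0 forces the
    positive weight times |u|^p to vanish almost everywhere. *)
Lemma C_gt0 : 0 < sobolev_const R n.+1 -> ~ sob_zero Theta u -> 0 < C.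
Proof.
move=> S0 un0; have [Clt _] := sobolev_weighted S0.
rewrite lt_neqAle Rintegral_ge0// andbT; apply: contra_notN un0 => /eqP C0.
have int0 : (\int[mu]_(x in Theta) `|(x1 x ^+ k * `|u.1 x| `^ p)%:E| = 0)%E.
  rewrite (eq_integral (fun x => (x1 x ^+ k * `|u.1 x| `^ p)%:E)); last first.
    by move=> x; rewrite inE => Tx; rewrite gee0_abs// lee_fin ge0_Cfun.
  rewrite -[LHS]fineK; first by congr EFin; rewrite C0.
  rewrite ge0_fin_numE//.
  by apply: integral_ge0 => x Tx; rewrite lee_fin ge0_Cfun.
have mC : measurable_fun Theta (fun x => (x1 x ^+ k * `|u.1 x| `^ p)%:E).
  exact/measurable_EFinP.
move/(ae_eq_integral_abs mu mTheta mC) : int0; apply: filterS => x h Tx.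
move: (h Tx) => /= [] /eqP.
have t0 := hpos (subset_closure Tx).
rewrite mulf_eq0 expf_eq0 (gt_eqF t0) andbF/= powR_eq0 normr_eq0.
by case/andP => /eqP.
Qed.

Lemma nehari_energy_ge : ~ sob_zero Theta u -> denergy Theta k lam u u = 0 ->
  kappa Theta k <= energy Theta k lam u.
Proof.
move=> un0.
have [[[mu1 _] LDu _] _] := Hu.
have x10 x : Theta x -> 0 <= x1 x by move=> /subset_closure/hpos/ltW.
rewrite denergy_self// -/A -/B -/C => [dE|i]; last exact: (LDu i).1.
have h := N3.
(* The constraint gives A - lam B = C, and 1/2 - 1/p = 1/N. *)
have -> : energy Theta k lam u = C / N.
  have -> : energy Theta k lam u = 1 / 2 * A - lam / 2 * B - 1 / p * C by [].
  have -> : 1 / 2 * A - lam / 2 * B = C / 2 by lra.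
  by rewrite /crit_exp; field; apply/andP; split; rewrite gt_eqF//; lra.
have C0 : 0 <= C by apply: Rintegral_ge0.
have S0 := @sobolev_const_ge0 R n.+1.
have N20 : 0 < N / 2 by lra.
rewrite /kappa -/K mulrCA -mulrA mul1r mulrC ler_pM2r ?invr_gt0; last by lra.
(* If the constant is 0, then so is kappa, and C >= 0 suffices. *)
move: S0; rewrite le_eqVlt => /predU1P[<-|S0]; first by rewrite powR0 ?gt_eqF// mulr0.
have [_ SG] := sobolev_weighted S0.
have Cp := C_gt0 S0 un0.
(* Chain kap S C^(2/p) <= kap G <= A - lam B = C, then divide by C^(2/p), using 2/N + 2/p = 1.
   Raising to the power N/2 afterwards gives K S^(N/2) <= C. *)
have KC : kap * sobolev_const R n.+1 <= C `^ (2 / N).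
  have E : C = C `^ (2 / N) * C `^ (2 / p).
    rewrite -powRD; last by rewrite (gt_eqF Cp) implybT.
    rewrite (_ : 2 / N + 2 / p = 1) ?powRr1//.
    by rewrite /crit_exp; field; apply/andP; split; rewrite gt_eqF//; lra.
  rewrite -(@ler_pM2r _ (C `^ (2 / p))) ?powR_gt0// -E -mulrA.
  apply: le_trans (_ : kap * G <= _); first by rewrite ler_wpM2l.
  by apply: le_trans weighted_hardy _; lra.
have KN : (kap * sobolev_const R n.+1) `^ (N / 2) =
    K * sobolev_const R n.+1 `^ (N / 2).
  rewrite powRM// /kap -?powRrM ?(ltW S0)//.
  rewrite (_ : 2 / N * (N / 2) = 1) ?powRr1 ?inf_x1X_ge0//.
  by field; rewrite gt_eqF//; lra.
have CN : (C `^ (2 / N)) `^ (N / 2) = C.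
  rewrite -powRrM (_ : 2 / N * (N / 2) = 1) ?powRr1//.
  by field; rewrite gt_eqF//; lra.
rewrite -KN -[leRHS]CN; apply: (ge0_ler_powR (ltW N20)) => //; rewrite nnegrE.
- by rewrite mulr_ge0// ltW.
- exact: powR_ge0.
Qed.

End ground_state.

(** * The lower bound for the critical parameter *)

Unset Implicit Arguments.

(* The dimension is n.+1. *)
Theorem proposition4p4 (R : realType) (n : nat) (hn : (3 <= n.+1)%N)
    (Theta : set 'rV[R]_n.+1)
    (hTheta : bounded_smooth_domain Theta)
    (hpos : forall x, closure Theta x -> 0 < x1 x)
    (hratio : x1_max Theta / x1_min Theta <= n.+1%:R / (n.+1%:R - 2)) :
  forall k : nat, (1 <= k)%N ->
    ((k%:R ^+ 2 / (4 * x1_max Theta ^+ 2))%:E <= lambda0star Theta k)%E /\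
    0 < k%:R ^+ 2 / (4 * x1_max Theta ^+ 2).
Proof.
move=> k k1; have [oT _ T0 bT _] := hTheta.
have b0 := x1_max_gt0 T0 bT hpos.
split; last first.
  by apply: divr_gt0; [|apply: mulr_gt0 => //]; apply: exprn_gt0; rewrite ?ltr0n.
apply: le_ereal_inf_tmp => _ [lam [_ lell] <-].
(* Below the threshold every point of the Nehari manifold has energy at least kappa, so the infimum
   cannot be smaller than kappa. *)
rewrite lee_fin leNgt; apply/negP => lam_lt; move: lell; apply/negP.
rewrite -leNgt; apply: le_ereal_inf_tmp => _ [u [Hu un0 dE] <-].
rewrite lee_fin; apply: nehari_energy_ge => //.
apply: le_trans (ltW lam_lt) _; rewrite (_ : _ / _ = (k%:R / (2 * x1_max Theta)) ^+ 2)//.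
by field; rewrite gt_eqF.
Qed.
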